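(* Let $G$ be a connected graph with maximum degree $\Delta \leq 5$ in which every non-trivial automorphism moves infinitely many vertices. Then $D(G) \leq 2$.
   Context: All graphs are simple, connected and locally finite. A distinguishing $k$-colouring of a graph $G=(V,E)$ is a map $c\colon V\to\{0,\dots,k-1\}$ such that the identity is the only automorphism $\gamma$ of $G$ with $c\circ\gamma=c$. The distinguishing number $D(G)$ is the least $k$ such that $G$ admits a distinguishing $k$-colouring. *)

(* Defs.v *)
From Stdlib Require Import List Relations.
Import ListNotations.

Record graph := {
  vert :> Type;
  adj : vert -> vert -> Prop;
  adj_sym : forall x y, adj x y -> adj y x;
  adj_irrefl : forall x, ~ adj x x
}.

Definition connected (G : graph) : Prop :=
  forall x y : G, clos_refl_trans G (adj G) x y.

Definition deg_le (G : graph) (v : G) (d : nat) : Prop :=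
  exists l : list G, NoDup l /\ length l <= d /\ forall w, adj G v w <-> In w l.

Definition max_degree_le (G : graph) (d : nat) : Prop :=
  forall v : G, deg_le G v d.

Definition automorphism (G : graph) (g : G -> G) : Prop :=
  (exists h : G -> G, (forall x, h (g x) = x) /\ (forall x, g (h x) = x)) /\
  (forall x y, adj G x y <-> adj G (g x) (g y)).

Definition finite_pred {V : Type} (P : V -> Prop) : Prop :=
  exists l : list V, forall v, P v -> In v l.

Definition infinite_motion_of (G : graph) (g : G -> G) : Prop :=
  ~ finite_pred (fun v => g v <> v).

Definition distinguishing (G : graph) (k : nat) (c : G -> nat) : Prop :=
  (forall v, c v < k) /\
  forall g, automorphism G g -> (forall v, c (g v) = c v) -> forall v, g v = v.

Definition dist_number_le (G : graph) (k : nat) : Prop :=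
  exists c : G -> nat, distinguishing G k c.

(* Main.v *)
(* A partial colouring is extended step by step, together with the group L of the
   automorphisms compatible with it and the subgroup K of L fixing pointwise the
   ball of radius 4 around a root.  The ball of radius 3 is black, the rest of the
   ball of radius 4 is white, and every later black vertex gets a white vertex
   within distance 3; hence an automorphism preserving the final colouring
   preserves both balls.  The K-orbits of coloured vertices have size at most 3.

   As finite-support automorphisms are trivial, a coloured vertex u moved by K is
   linked, through coloured vertices on which K acts as on Ku, to some x having an
   uncoloured neighbour y adjacent to a part only of Kx.  Then Ky is cut into |Kx|
   classes of the same size q, and q <= 4 since the neighbours of y that are
   coloured have a coloured neighbour.  Putting unequal numbers of black vertices
   into the classes breaks up Kx, hence Ku.  Iterating, K fixes every vertex in the
   limit.

   First one has to reach L = K.  If Ky differs from a translate gKy with g in L,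
   colouring the two sets with different numbers of black vertices kills the class
   gK; this is possible unless |Kx| = 3 and q >= 3, where only one number of black
   vertices keeps the orbits small and breaks Kx. *)
Require Import Defs.
From Stdlib Require Import Relations.
From HB Require Import structures.
From mathcomp Require Import all_boot zify.
From mathcomp Require Import boolp.

Set Implicit Arguments.
Unset Strict Implicit.
Unset Printing Implicit Defensive.

(** * Finite predicates *)

Section Cardinal.
Variable T : eqType.
Implicit Types (A B : T -> Prop) (s : seq T).

Definition fin A := exists s, forall x, A x -> x \in s.

(** An infinite predicate gets the empty list, hence [card] 0; so a positive [card] already implies
    finiteness. *)
Definition elems A : seq T :=
  if pselect (fin A) is left h then undup [seq x <- projT1 (cid h) | `[< A x >]]
  else [::].

Definition card A := size (elems A).

Lemma elems_uniq A : uniq (elems A).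
Proof. by rewrite /elems; case: pselect => // h; exact: undup_uniq. Qed.

Lemma elemsP A x : fin A -> (x \in elems A) <-> A x.
Proof.
move=> h; rewrite /elems; case: pselect => // h'.
rewrite mem_undup mem_filter; case: cid => s /= hs.
by split=> [/andP[/asboolP]//|ax]; rewrite hs // andbT; apply/asboolP.
Qed.

Lemma fin_sub A B : (forall x, A x -> B x) -> fin B -> fin A.
Proof. by move=> AB [s hs]; exists s => x /AB /hs. Qed.

Lemma card_uniq s A : uniq s -> (forall x, x \in s <-> A x) -> card A = size s.
Proof.
move=> us sA; have fA : fin A by exists s => x /sA.
apply: perm_size; apply: uniq_perm => //; first exact: elems_uniq.
by move=> x; apply/idP/idP => [/(elemsP _ fA)/sA|/sA/(elemsP _ fA)].
Qed.

Lemma card_eq A B : (forall x, A x <-> B x) -> card A = card B.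
Proof. by move=> AB; congr card; apply/funext => x; apply/propext. Qed.

Lemma card_le_seq s A : (forall x, A x -> x \in s) -> card A <= size s.
Proof.
move=> h; have fA : fin A by exists s.
by apply: uniq_leq_size; [exact: elems_uniq|move=> x /(elemsP _ fA)/h].
Qed.

Lemma card_ge_seq s A : fin A -> uniq s -> (forall x, x \in s -> A x) -> size s <= card A.
Proof. by move=> fA us sA; apply: uniq_leq_size => // x /sA /(elemsP _ fA). Qed.

Lemma card_le A B : fin B -> (forall x, A x -> B x) -> card A <= card B.
Proof. by move=> fB AB; apply: card_le_seq => x /AB /(elemsP _ fB). Qed.

Lemma card_gt0 A x : fin A -> A x -> 0 < card A.
Proof. by move=> fA ax; apply: (@card_ge_seq [:: x]) => // y; rewrite inE => /eqP->. Qed.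

Lemma card_le_eq A B : fin B -> (forall x, A x -> B x) -> card B <= card A ->
  forall x, B x -> A x.
Proof.
move=> fB AB le x Bx; have fA := fin_sub AB fB.
have [_ h] := uniq_min_size (elems_uniq A)
  (fun y (hy : y \in elems A) => (elemsP y fB).2 (AB y ((elemsP y fA).1 hy))) le.
by apply/(elemsP _ fA); rewrite h; apply/(elemsP _ fB).
Qed.

Lemma card_lt A B x : fin B -> (forall y, A y -> B y) -> B x -> ~ A x -> card A < card B.
Proof.
move=> fB AB Bx nAx; rewrite ltnNge; apply/negP => le.
exact/nAx/(card_le_eq fB AB le).
Qed.

Lemma card_inj A B (f : T -> T) : fin B -> (forall x, A x -> B (f x)) ->
  (forall x y, A x -> A y -> f x = f y -> x = y) -> card A <= card B.
Proof.
move=> fB AB inj; case: (pselect (fin A)) => [fA|nfA]; last first.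
  by rewrite /card /elems; case: pselect.
rewrite -[card A](size_map f); apply: card_ge_seq => //.
  rewrite map_inj_in_uniq ?elems_uniq // => x y /(elemsP _ fA) ax /(elemsP _ fA) ay.
  exact: inj.
by move=> x /mapP[y /(elemsP _ fA) ay ->]; exact: AB.
Qed.

Lemma fin_or A B : fin A -> fin B -> fin (fun x => A x \/ B x).
Proof.
move=> [s hs] [t ht]; exists (s ++ t) => x; rewrite mem_cat.
by case=> [/hs->//|/ht->]; rewrite orbT.
Qed.

Lemma fin_bigcup (U : eqType) (s : seq U) (F : U -> T -> Prop) :
  (forall u, u \in s -> fin (F u)) -> fin (fun x => exists2 u, u \in s & F u x).
Proof.
elim: s => [|u s IH] h; first by exists [::] => x [].
have [t ht] : fin (fun x => exists2 u, u \in s & F u x).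
  by apply: IH => v vs; apply: h; rewrite inE vs orbT.
have [r hr] := h u (mem_head _ _).
exists (r ++ t) => x [v]; rewrite inE mem_cat => /orP[/eqP->|vs] Fx; first by rewrite hr.
by rewrite (ht x) ?orbT //; exists v.
Qed.

Lemma card_or A B : fin A -> fin B -> card (fun x => A x \/ B x) <= card A + card B.
Proof.
move=> fA fB; rewrite /card -size_cat; apply: card_le_seq => x.
by rewrite mem_cat => -[/(elemsP _ fA)->//|/(elemsP _ fB)->]; rewrite orbT.
Qed.

Lemma card_disj A B : fin A -> fin B -> (forall x, A x -> B x -> False) ->
  card (fun x => A x \/ B x) = card A + card B.
Proof.
move=> fA fB dis; rewrite {2 3}/card -size_cat; apply: card_uniq.
  rewrite cat_uniq !elems_uniq andbT /=; apply/hasPn => x /(elemsP _ fB) bx.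
  by apply/negP => /(elemsP _ fA) ax; exact: dis bx.
move=> x; rewrite mem_cat; split=> [/orP[]|[]].
- by move=> /(elemsP _ fA); left.
- by move=> /(elemsP _ fB); right.
- by move=> /(elemsP _ fA) ->.
by move=> /(elemsP _ fB) ->; rewrite orbT.
Qed.

Lemma card_subset A n : fin A -> n <= card A ->
  exists2 B : T -> Prop, (forall x, B x -> A x) & card B = n.
Proof.
move=> fA le; exists (fun x => x \in take n (elems A)).
  by move=> x /mem_take /(elemsP _ fA).
rewrite (@card_uniq (take n (elems A))) //; last exact: take_uniq (elems_uniq A).
by rewrite size_takel.
Qed.

Lemma card_subset_mem A a n : fin A -> A a -> 0 < n <= card A ->
  exists2 B : T -> Prop, (forall x, B x -> A x) & card B = n /\ B a.
Proof.
move=> fA Aa /andP[n0 le].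
have ea := (elemsP a fA).2 Aa.
pose t := a :: take n.-1 (rem a (elems A)).
have ut : uniq t.
  rewrite /= take_uniq ?rem_uniq ?elems_uniq // andbT; apply/negP => /mem_take.
  by rewrite mem_rem_uniq ?elems_uniq // inE eqxx.
exists (fun x => x \in t).
  move=> x; rewrite inE => /orP[/eqP->//|/mem_take/mem_rem].
  by move/(elemsP _ fA).
split; last exact: mem_head.
rewrite (@card_uniq t) //= size_takel ?size_rem // -/(card A); lia.
Qed.

Lemma card_split A (P : T -> Prop) : fin A ->
  card A = card (fun x => A x /\ P x) + card (fun x => A x /\ ~ P x).
Proof.
move=> fA; rewrite -card_disj.
- apply: card_eq => x; split=> [ax|[[]|[]]//].
  by case: (pselect (P x)); [left|right].
- by apply: fin_sub fA => x [].
- by apply: fin_sub fA => x [].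
by move=> x [_ p] [_].
Qed.

Lemma card1_eq A x y : fin A -> card A <= 1 -> A x -> A y -> x = y.
Proof.
move=> fA le ax ay; apply/eqP/negP => /negP ne.
have := @card_ge_seq [:: x; y] A fA; rewrite /= inE ne => /(_ isT) h.
suff : 2 <= card A by lia.
by apply: h => z; rewrite !inE => /orP[]/eqP->.
Qed.

Lemma card_has A : 0 < card A -> exists x, A x.
Proof.
move=> c0; have fA : fin A by move: c0; rewrite /card /elems; case: pselect.
move: c0; rewrite /card; case E: (elems A) => [//|x t] _; exists x.
by apply/(elemsP _ fA); rewrite E mem_head.
Qed.

End Cardinal.

Lemma fin_words (T : eqType) (d : seq T) n :
  fin (fun w : seq T => size w = n /\ {subset w <= d}).
Proof.
elim: n => [|n [l hl]]; first by exists [:: [::]] => w [/size0nil->].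
exists [seq x :: w | x <- d, w <- l] => -[|x w] [//= [sw] sub].
apply: allpairs_f; first by apply: sub; exact: mem_head.
by apply: hl; split=> // z zw; apply: sub; rewrite inE zw orbT.
Qed.

Lemma lex3_ind (T : Type) (m1 m2 m3 : T -> nat) (P : T -> Prop) :
  (forall s, (forall t, [|| m1 t < m1 s, (m1 t <= m1 s) && (m2 t < m2 s) |
      [&& m1 t <= m1 s, m2 t <= m2 s & m3 t < m3 s]] -> P t) -> P s) ->
  forall s, P s.
Proof.
move=> step s; move e1 : (m1 s) => c1; move e2 : (m2 s) => c2; move e3 : (m3 s) => c3.
elim/ltn_ind: c1 c2 c3 s e1 e2 e3 => c1 IH1.
elim/ltn_ind => c2 IH2; elim/ltn_ind => c3 IH3 s e1 e2 e3.
apply: step => t; rewrite e1 e2 e3 => h.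
case: (ltnP (m1 t) c1) => h1; first exact: IH1 erefl erefl erefl.
have {}h1 : m1 t = c1 by lia.
case: (ltnP (m2 t) c2) => h2; first exact: IH2 h1 erefl erefl.
by apply: (IH3 (m3 t)) => //; lia.
Qed.

(** * Infinite motion and orbits *)

Definition is_aut (T : Type) (e : T -> T -> Prop) (g : T -> T) :=
  (exists h, cancel g h /\ cancel h g) /\ forall x y, e x y <-> e (g x) (g y).

(** Infinite motion appears as its contrapositive; connectedness enters only as a hypothesis of
    [world_distinguishing]. *)
Record world := World {
  V : eqType;
  E : V -> V -> Prop;
  E_sym : forall x y, E x y -> E y x;
  nb : V -> seq V;
  nbP : forall x y, E x y <-> y \in nb x;
  nb_uniq : forall x, uniq (nb x);
  nb_size : forall x, size (nb x) <= 5;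
  root : V;
  motion : forall g, is_aut E g -> fin (fun x => g x <> x) -> forall x, g x = x
}.

Section Basics.
Variable W : world.
Notation V := (V W).
Notation E := (@E W).
Implicit Types (x y z a b : V) (g h k : V -> V) (L K : (V -> V) -> Prop).

Lemma E_fin x : fin (E x).
Proof. by exists (nb x) => y /nbP. Qed.

Lemma E_card x : card (E x) <= 5.
Proof. by apply: leq_trans (nb_size x); apply: card_le_seq => y /nbP. Qed.

Fixpoint ball n x : V -> Prop :=
  if n is m.+1 then fun y => ball m x y \/ exists2 z, ball m x z & E z y else eq x.

Lemma ball_refl n x : ball n x x.
Proof. by elim: n => //= n IH; left. Qed.

Lemma ball_cons n x y z : E x y -> ball n y z -> ball n.+1 x z.
Proof.
move=> xy; elim: n z => [|n IH] z /=.
  by move=> <-; right; exists x.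
case=> [/IH h|[t /IH h tz]]; first by left.
by right; exists t.
Qed.

Lemma ball_fin n x : fin (ball n x).
Proof.
elim: n => [|n IH]; first by exists [:: x] => y <-; rewrite mem_head.
apply: fin_or => //; case: IH => s hs.
have [t ht] := fin_bigcup (F := E) (s := s) (fun u _ => E_fin u).
by exists t => y [z /hs zs zy]; apply: ht; exists z.
Qed.

Lemma aut_inj g : is_aut E g -> injective g.
Proof. by case=> -[h [gh _]] _; exact: can_inj gh. Qed.

Lemma aut_ball g n x y : is_aut E g -> ball n x y -> ball n (g x) (g y).
Proof.
move=> [_ ag]; elim: n y => [|n IH] y /=; first by move=> ->.
case=> [/IH h|[z /IH h /ag zy]]; [by left|by right; exists (g z)].
Qed.

Lemma aut_ball_inv g n x y : is_aut E g -> ball n (g x) y ->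
  exists2 z, ball n x z & g z = y.
Proof.
move=> [[h [gh hg]] ag]; elim: n y => [|n IH] y /=; first by move=> <-; exists x.
case=> [/IH[z xz <-]|[t /IH[z xz <-] ty]]; first by exists z => //; left.
by exists (h y); rewrite ?hg //; right; exists z => //; apply/ag; rewrite hg.
Qed.

Definition Ball4 := ball 4 (root W).
Definition Ball3 := ball 3 (root W).

Record is_group L : Prop := IsGroup {
  grp_aut : forall g, L g -> is_aut E g;
  grp_id : L id;
  grp_comp : forall g h, L g -> L h -> L (g \o h);
  grp_inv : forall g, L g -> exists2 h, L h & cancel g h /\ cancel h g
}.

Definition orb L x y := exists2 g, L g & g x = y.

Lemma orb_refl L x : is_group L -> orb L x x.
Proof. by move=> gL; exists id => //; exact: grp_id gL. Qed.

Lemma orb_img L g x : L g -> orb L x (g x).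
Proof. by exists g. Qed.

Lemma orb_sym L x y : is_group L -> orb L x y -> orb L y x.
Proof.
by move=> gL [g /(grp_inv gL)[h Lh [gh _]] <-]; exists h.
Qed.

Lemma orb_trans L x y z : is_group L -> orb L x y -> orb L y z -> orb L x z.
Proof.
move=> gL [g Lg <-] [h Lh <-]; exists (h \o g) => //; exact: grp_comp.
Qed.

Lemma orb_step L x y g : is_group L -> L g -> orb L x y -> orb L x (g y).
Proof. by move=> gL Lg xy; apply: orb_trans xy _ => //; exact: orb_img. Qed.

Lemma orb_eqv L x y z : is_group L -> orb L x y -> orb L x z <-> orb L y z.
Proof.
move=> gL xy; split=> h; last exact: orb_trans h.
by apply: orb_trans h => //; exact: orb_sym.
Qed.

(* A partial automorphism with finite support extends by the identity, so
   infinite motion forces it to be trivial. *)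
Lemma patch (S : V -> Prop) L g : is_group L -> L g -> fin S ->
  (forall h x, (h = g \/ cancel g h) -> L h -> S x -> S (h x)) ->
  (forall x y, S x -> ~ S y -> E x y <-> E (g x) y) ->
  forall x, S x -> g x = x.
Proof.
move=> gL Lg fS Sg nbS x Sx.
have [h Lh [gh hg]] := grp_inv gL Lg.
have Sh y : S y -> S (h y) by apply: Sg => //; right.
have Sgg y : S y -> S (g y) by apply: Sg => //; left.
pose pg y := if `[< S y >] then g y else y.
pose ph y := if `[< S y >] then h y else y.
suff: pg x = x by rewrite /pg asboolT.
apply: (motion (w := W)); last first.
  by apply: fin_sub fS => y; rewrite /pg; case: asboolP.
split.
  exists ph; split=> y; rewrite /ph /pg; case: (asboolP (S y)) => Sy.
  - by rewrite asboolT ?gh //; exact: Sgg.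
  - by rewrite asboolF.
  - by rewrite asboolT ?hg //; exact: Sh.
  - by rewrite asboolF.
have ag := (grp_aut gL Lg).2.
move=> y z; rewrite /pg; case: asboolP => Sy; case: asboolP => Sz //.
- exact: nbS.
by split=> /E_sym yz; apply: E_sym; apply/(nbS z y Sz Sy).
Qed.

(** Splitting is what obstructs [patch]: for an element of [K] the boundary condition there holds
    when no outer vertex splits an inner one. *)
Definition splits K y x := (exists2 k, K k & E y (k x)) /\ (exists2 k, K k & ~ E y (k x)).

Lemma splits_orb K y x y' x' : is_group K -> splits K y x -> orb K y y' -> orb K x x' ->
  splits K y' x'.
Proof.
move=> gK [[k Kk yk] [l Kl yl]] [m Km <-] [n Kn <-].
have [n' Kn' [nn' n'n]] := grp_inv gK Kn.
have am := (grp_aut gK Km).2.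
split.
  exists (m \o k \o n'); first by apply: (grp_comp gK) => //; apply: (grp_comp gK).
  by rewrite /= nn' -am.
exists (m \o l \o n'); first by apply: (grp_comp gK) => //; apply: (grp_comp gK).
by rewrite /= nn' -am.
Qed.

(* The values of [f] are the vertices of the orbit of [x] which are adjacency
   singletons: the unique neighbour, or else the unique non-neighbour. *)
Lemma splits_proj K y x : is_group K -> fin (orb K x) -> card (orb K x) <= 3 ->
  splits K y x ->
  exists f : V -> V, [/\ forall z, orb K y z -> orb K x (f z),
    forall z k, orb K y z -> K k -> f (k z) = k (f z),
    forall z t, orb K y z -> orb K y t -> f z = f t ->
      exists2 p, orb K x p & E p z /\ E p t &
    forall z t p, orb K y z -> orb K y t -> f z = f t -> orb K x p ->
      E p z -> E p t].
Proof.
move=> gK fP cP sp.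
pose Sp (pol : bool) z p := orb K x p /\ (if pol then E p z else ~ E p z).
(* An orbit of size at most 3 cut into two non-empty parts has a part of size 1; [pol] says whether
   this part consists of neighbours. *)
have [pol [p0 Sp0 up0]] : exists pol, exists2 p0, Sp pol y p0 & forall p, Sp pol y p -> p = p0.
  case: sp => [[k Kk yk] [l Kl yl]].
  pose A p := orb K x p /\ E p y; pose B p := orb K x p /\ ~ E p y.
  have fA : fin A by apply: fin_sub fP => ? [].
  have fB : fin B by apply: fin_sub fP => ? [].
  have cAB : card A + card B <= 3 by rewrite -card_split.
  have Ak : A (k x) by split; [exact: orb_img|exact: E_sym].
  have Bl : B (l x) by split; [exact: orb_img|move=> /E_sym].
  have A0 := card_gt0 fA Ak; have B0 := card_gt0 fB Bl.
  case: (leqP (card A) 1) => cA.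
    exists true, (k x) => // p pA; exact: (card1_eq fA cA).
  exists false, (l x) => // p pB; apply: (card1_eq fB) => //; lia.
have SpK z p k : K k -> Sp pol z p -> Sp pol (k z) (k p).
  move=> Kk [op h]; split; first exact: orb_step.
  have ak := (grp_aut gK Kk).2.
  by move: h; case: pol {Sp0 up0} => h; rewrite -ak.
have ex z : exists p, orb K y z -> Sp pol z p.
  case: (pselect (orb K y z)) => [[k Kk <-]|]; last by exists x.
  by exists (k p0) => _; exact: SpK.
have un z p q : orb K y z -> Sp pol z p -> Sp pol z q -> p = q.
  move=> yz; have [k Kk kz] := orb_sym gK yz.
  move=> /(SpK _ _ _ Kk) + /(SpK _ _ _ Kk); rewrite kz => /up0 e /up0 e'.
  by apply: (aut_inj (grp_aut gK Kk)); rewrite e e'.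
have [f hf] := choice ex.
(* A point of the orbit other than the singleton has the opposite adjacency, so the singleton
   determines all adjacencies. *)
have same z t p : orb K y z -> orb K y t -> f z = f t -> orb K x p -> E p z -> E p t.
  move=> yz yt ft xp pz; have /= [_] := hf z yz; have [_] := hf t yt.
  case: (eqVneq p (f t)) => [ep|ne].
    by rewrite ft -ep; case: (pol).
  case epol: pol => h1 h2.
    have : p = f z by apply: (un z) => //; [split=> //; rewrite epol|exact: hf].
    by rewrite ft => e; rewrite e eqxx in ne.
  apply: contrapT => npt; move/eqP: ne; apply.
  by apply: (un t) => //; [split=> //; rewrite epol|exact: hf].
exists f; split=> //.
- by move=> z yz; case: (hf z yz).
- move=> z k yz Kk; apply: (un (k z)); first exact: orb_step.
    by apply: hf; exact: orb_step.
  by apply: SpK => //; exact: hf.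
move=> z t yz yt ft.
have [[k Kk yk] _] := splits_orb gK sp yz (orb_refl x gK).
exists (k x); first exact: orb_img.
by split; [exact: E_sym|apply: (same z) => //; [exact: orb_img|exact: E_sym]].
Qed.

Lemma splits_card_gt1 K y x : is_group K -> fin (orb K x) -> splits K y x -> 1 < card (orb K x).
Proof.
move=> gK fP [[k Kk yk] [l Kl yl]]; rewrite ltnNge; apply/negP => c1.
by apply: yl; rewrite (card1_eq fP c1 (orb_img x Kl) (orb_img x Kk)).
Qed.

(** The map [f] of [splits_proj] is an equivariant bijection: two points of one fibre and their
    images in another would be four points of the orbit of [y]. Transitivity of a subgroup is
    carried along [f]. *)
Lemma splits_iso K y x : is_group K -> fin (orb K x) -> card (orb K x) <= 3 ->
  fin (orb K y) -> card (orb K y) <= 3 -> splits K y x ->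
  card (orb K y) = card (orb K x) /\
  forall K', is_group K' -> (forall k, K' k -> K k) ->
    (forall z, orb K x z -> orb K' x z) -> forall z, orb K y z -> orb K' y z.
Proof.
move=> gK fx cx fy cy sp.
have [f [f1 f2 f3 f4]] := splits_proj gK fx cx sp.
have [[l0 Kl0 _] _] := sp.
have yy := orb_refl y gK.
have finj z t : orb K y z -> orb K y t -> f z = f t -> z = t.
  move=> yz yt ft; apply: contrapT => /eqP ne.
  have [p xp pf] : exists2 p, orb K x p & p != f z.
    have c1 := splits_card_gt1 gK fx sp.
    apply: contrapT => h; have : card (orb K x) <= 1; last by lia.
    apply: (@card_le_seq _ [:: f z]) => p xp; rewrite inE; apply: contrapT => /negP pf.
    by apply: h; exists p.
  have [m Km mp] : orb K (f z) p by apply/(orb_eqv _ gK (f1 _ yz)).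
  have ymz := orb_step gK Km yz; have ymt := orb_step gK Km yt.
  have fm u : orb K y u -> f u = f z -> f (m u) = p by move=> yu fu; rewrite f2 // fu.
  have im := aut_inj (grp_aut gK Km).
  suff : 4 <= card (orb K y) by lia.
  apply: (@card_ge_seq _ [:: z; t; m z; m t]) => //=; last first.
    by move=> u; rewrite !inE => /or4P[]/eqP->.
  have ne1 u v : f u = f z -> orb K y v -> f v = f z -> u == m v = false.
    move=> fu yv fv; apply/negP => /eqP e; move/eqP: pf; apply.
    by rewrite -(fm v) // -e.
  by rewrite !inE (ne1 z z) ?(ne1 z t) ?(ne1 t z) ?(ne1 t t) ?(inj_eq im) ?(negbTE ne).
split.
  apply/eqP; rewrite eqn_leq; apply/andP; split.
    by apply: (@card_inj _ _ _ f).
  have ex p : exists z, orb K x p -> orb K y z /\ f z = p.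
    case: (pselect (orb K x p)) => xp; last by exists p.
    have [m Km mp] : orb K (f y) p by apply/(orb_eqv _ gK (f1 _ yy)).
    by exists (m y) => _; split; [exact: orb_img|rewrite f2].
  have [r hr] := choice ex.
  apply: (@card_inj _ _ _ r) => //; first by move=> p /hr[].
  by move=> p q /hr[_ fp] /hr[_ fq] e; rewrite -fp e fq.
move=> K' gK' sK tr z [k Kk <-].
have [h Kh hh] : orb K' (f y) (k (f y)).
  have xf : orb K' x (f y) by apply: tr; exact: f1.
  apply/(orb_eqv _ gK' xf); apply: tr; apply: orb_step => //; exact: f1.
exists h => //; apply: finj; first exact: orb_img (sK _ Kh).
  exact: orb_img.
by rewrite !f2 //; exact: sK.
Qed.

End Basics.

(** * Partial colourings *)

Section States.
Variable W : world.
Notation V := (V W).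
Notation E := (@E W).
Notation Ball4 := (@Ball4 W).
Notation Ball3 := (@Ball3 W).

(** [grp] is the group L of the overview and [ker] below is K; [col] has a meaning only on [dom]. *)
Record state := State {
  dom : V -> Prop;
  col : V -> bool;
  grp : (V -> V) -> Prop
}.

Implicit Types (s t : state) (x y z a b : V) (g h k : V -> V) (Q : V -> Prop) (f : V -> bool).

Definition ker s g := grp s g /\ forall x, Ball4 x -> g x = x.

Definition moved s x := exists2 k, ker s k & k x <> x.

Definition near s n x := exists w, [/\ dom s w, ~~ col s w & ball n x w].

(* [good_near] makes the black ball of radius 3 recognizable; its stronger form for
   moved vertices allows an adjacent vertex to be black without a white sibling.
   [good_all]: automorphisms preserving some total extension are not lost. *)
Record good s : Prop := Good {
  good_fin : fin (dom s);
  good_Ball4 : forall x, Ball4 x -> dom s x;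
  good_grp : is_group (grp s);
  good_dom : forall g x, grp s g -> dom s x -> dom s (g x);
  good_dom0 : forall g x, grp s g -> Ball4 x -> Ball4 (g x);
  good_col : forall g x, grp s g -> dom s x -> col s (g x) = col s x;
  good_deg : forall x y, dom s x -> ~ dom s y -> E x y -> exists2 z, dom s z & E x z;
  good_card : forall x, dom s x -> card (orb (ker s) x) <= 3;
  good_near : forall x, dom s x -> col s x -> ~ Ball3 x ->
    near s 3 x /\ (moved s x -> near s 2 x);
  good_all : forall chi : V -> bool, (forall x, dom s x -> chi x = col s x) ->
    forall g, is_aut E g -> (forall x, Ball4 x <-> Ball4 (g x)) ->
    (forall x, chi (g x) = chi x) -> grp s g
}.

Definition ext s t := [/\ forall x, dom s x -> dom t x,
  forall x, dom s x -> col t x = col s x & forall g, grp t g -> grp s g].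

Lemma ext_refl s : ext s s.
Proof. by split. Qed.

Lemma ext_trans s t u : ext s t -> ext t u -> ext s u.
Proof.
move=> [d1 c1 g1] [d2 c2 g2]; split=> x; [by move=> /d1/d2| |by move=> /g2/g1].
by move=> dx; rewrite c2 ?c1 //; exact: d1.
Qed.

Lemma ext_near s t n x : ext s t -> near s n x -> near t n x.
Proof. by move=> [d c _] [w [dw cw xw]]; exists w; split; rewrite ?c //; exact: d. Qed.

Lemma ext_ker s t k : ext s t -> ker t k -> ker s k.
Proof. by move=> [_ _ gg] [/gg gk k0]. Qed.

Lemma ext_moved s t x : ext s t -> moved t x -> moved s x.
Proof. by move=> st [k kk kx]; exists k => //; exact: ext_ker kk. Qed.

Lemma near_ball s m n x y : (forall w, ball m x w -> ball n y w) -> near s m x -> near s n y.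
Proof. by move=> h [w [dw cw xw]]; exists w; split=> //; exact: h. Qed.

Lemma grp_near s n g x : good s -> grp s g -> near s n x -> near s n (g x).
Proof.
move=> gs sg [w [dw cw xw]]; exists (g w); split.
- exact: good_dom.
- by rewrite (good_col gs).
exact: aut_ball (grp_aut (good_grp gs) sg) xw.
Qed.

Lemma ker_group s : good s -> is_group (ker s).
Proof.
move=> gs; have gg := good_grp gs; split.
- by move=> g [/(grp_aut gg)].
- by split=> //; exact: grp_id gg.
- move=> g h [gg1 g0] [gh h0]; split; first exact: grp_comp.
  by move=> x x0 /=; rewrite h0 // g0.
move=> g [sg g0]; have [h sh [gh hg]] := grp_inv gg sg; exists h => //.
by split=> // x x0; rewrite -{1}(g0 x x0) gh.
Qed.

(** The kernel is normal because the group preserves [Ball4]; hence the group permutes the kernel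
    orbits. *)
Lemma ker_conj s g h k : good s -> grp s g -> grp s h -> cancel g h -> ker s k ->
  ker s (h \o k \o g).
Proof.
move=> gs sg sh gh [sk k0]; split.
  by apply: (grp_comp (good_grp gs)) => //; apply: (grp_comp (good_grp gs)).
by move=> x x0 /=; rewrite k0 ?gh //; exact: (good_dom0 gs).
Qed.

Lemma orb_ker_grp s x y : orb (ker s) x y -> orb (grp s) x y.
Proof. by move=> [k [sk _] <-]; exists k. Qed.

Lemma ker_orb_conj s g x y : good s -> grp s g ->
  orb (ker s) x y <-> orb (ker s) (g x) (g y).
Proof.
move=> gs sg; have [h sh [gh hg]] := grp_inv (good_grp gs) sg.
split=> -[k kk e].
  by exists (g \o k \o h); [exact: (ker_conj (g := h))|rewrite /= gh e].
exists (h \o k \o g); first exact: (ker_conj (g := g)).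
by rewrite /= e gh.
Qed.

Definition outer s y := ~ dom s y /\ exists2 a, dom s a & E a y.

Lemma dom_orb s x y : good s -> dom s x -> orb (grp s) x y -> dom s y.
Proof. by move=> gs dx [g sg <-]; exact: good_dom. Qed.

Lemma ndom_grp s g y : good s -> grp s g -> ~ dom s y -> ~ dom s (g y).
Proof.
move=> gs sg dy dgy; apply: dy; have [h sh [gh hg]] := grp_inv (good_grp gs) sg.
by rewrite -[y]gh; exact: good_dom.
Qed.

Lemma outer_grp s g y : good s -> grp s g -> outer s y -> outer s (g y).
Proof.
move=> gs sg [ny [a da ay]]; split; first exact: ndom_grp.
exists (g a); first exact: good_dom.
by have [_ <-] := grp_aut (good_grp gs) sg.
Qed.

Lemma outer_fin s : good s -> fin (outer s).
Proof.
move=> gs; have [l hl] := good_fin gs.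
have [r hr] := fin_bigcup (s := l) (F := E) (fun u _ => E_fin u).
by exists r => y [_ [a /hl la ay]]; apply: hr; exists a.
Qed.

(** One of the at most five neighbours is coloured, by [good_deg]. This is the source of the bound 4
    on class sizes. *)
Lemma outer_deg s a : good s -> dom s a -> card (fun y => E a y /\ ~ dom s y) <= 4.
Proof.
move=> gs da; have fa := E_fin a.
case: (pselect (exists2 y, ~ dom s y & E a y)) => [[y ny ay]|no]; last first.
  rewrite (@card_uniq _ [::]) // => y; split=> // -[ay ny]; case: no.
  by exists y.
have [z dz az] := good_deg gs da ny ay.
suff : card (fun y => E a y /\ ~ dom s y) < card (E a) by have := E_card a; lia.
by apply: (@card_lt _ _ _ z) => //; [move=> ? []|case].
Qed.

Lemma orb_dom_fin s x : good s -> dom s x -> fin (orb (ker s) x).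
Proof.
move=> gs dx; apply: fin_sub (good_fin gs) => y /orb_ker_grp; exact: dom_orb.
Qed.

Lemma orb_outer s x y : good s -> outer s x -> orb (grp s) x y -> outer s y.
Proof. by move=> gs ox [g sg <-]; exact: outer_grp. Qed.

Lemma orb_outer_fin s x : good s -> outer s x -> fin (orb (grp s) x).
Proof. by move=> gs ox; apply: fin_sub (outer_fin gs) => y; exact: orb_outer. Qed.

Lemma moved_near s a : good s -> dom s a -> moved s a -> near s 2 a.
Proof.
move=> gs da ma; case ca: (col s a).
  apply: (good_near gs da ca _).2 => //; move=> a3; have [k [_ k0]] := ma.
  by case; apply: k0; left.
by exists a; split; rewrite ?ca //; exact: ball_refl.
Qed.

(** * Adding coloured vertices to a state *)

Definition add s Q f := State (fun x => dom s x \/ Q x)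
  (fun x => if `[< Q x >] then f x else col s x)
  (fun g => grp s g /\ forall x, Q x -> f (g x) = f x).

Lemma add_ext s Q f : (forall x, Q x -> outer s x) -> ext s (add s Q f).
Proof.
move=> Qo; split=> [x dx|x dx|g []//]; first by left.
by rewrite /= asboolF // => /Qo[].
Qed.

(** Invariance of [Q] gives the conditions on the group; the last two hypotheses are [good_card] and
    [good_near] for the new vertices. *)
Lemma add_good s Q f : good s -> (forall x, Q x -> outer s x) ->
  (forall g x, grp s g -> Q x -> Q (g x)) ->
  (forall x, Q x -> card (orb (ker (add s Q f)) x) <= 3) ->
  (forall x, Q x -> f x -> near (add s Q f) 3 x /\
     (moved (add s Q f) x -> near (add s Q f) 2 x)) -> good (add s Q f).
Proof.
move=> gs Qo Qg Q3 Qn; have gg := good_grp gs; have es := @add_ext s Q f Qo.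
have nQ x : dom s x -> `[< Q x >] = false.
  by move=> dx; apply: asboolF => /Qo[].
split.
- by apply: fin_or; [exact: good_fin|apply: fin_sub (outer_fin gs)].
- by move=> x /(good_Ball4 gs); left.
- split.
  + by move=> g [/(grp_aut gg)].
  + by split=> //; exact: grp_id gg.
  + move=> g h [sg fg] [sh fh]; split; first exact: grp_comp.
    by move=> x Qx /=; rewrite fg ?fh //; exact: Qg.
  move=> g [sg fg]; have [h sh [gh hg]] := grp_inv gg sg; exists h => //.
  by split=> // x Qx; rewrite -{2}[x]hg fg //; exact: Qg.
- by move=> g x [sg _] [dx|Qx]; [left; exact: good_dom|right; exact: Qg].
- by move=> g x [sg _]; exact: (good_dom0 gs).
- move=> g x [sg fg] [dx|Qx] /=.
    by rewrite !nQ ?(good_col gs) //; exact: good_dom.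
  by rewrite !asboolT ?fg //; exact: Qg.
- move=> x y [dx|Qx] ny xy.
    have [|z dz xz] := good_deg gs dx _ xy; first by move=> dy; apply: ny; left.
    by exists z => //; left.
  have [_ [z dz zx]] := Qo x Qx.
  by exists z; [left|exact: E_sym].
- move=> x [dx|Qx]; last exact: Q3.
  apply: leq_trans (good_card gs dx).
  apply: card_le; first exact: orb_dom_fin.
  by move=> y [k kk <-]; exists k => //; exact: ext_ker kk.
- move=> x [dx|Qx] /=; last by rewrite asboolT // => fx _; exact: Qn.
  rewrite nQ // => cx x3; have [n3 n2] := good_near gs dx cx x3.
  split; first exact: ext_near n3.
  by move=> mx; apply: (ext_near es); apply: n2; exact: ext_moved mx.
move=> chi hc g ag g0 cg; split.
  apply: (good_all gs (chi := chi)) => // x dx.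
  by rewrite hc /= ?nQ //; left.
move=> x Qx; have sg : grp s g.
  apply: (good_all gs (chi := chi)) => // y dy.
  by rewrite hc /= ?nQ //; left.
have Qgx := Qg g x sg Qx.
have := cg x; rewrite !hc /=; [|by right|by right].
by rewrite !asboolT.
Qed.

(** Only the colours on [O] count, so one kernel orbit can be studied alone and serve as a template
    for its translates. *)
Definition stab s (O : V -> Prop) f k := ker s k /\ forall z, O z -> f (k z) = f z.

(* What a colouring [f] of the orbit of [y] must satisfy to extend a good state:
   small orbits, and a white vertex near each black one, either a sibling [t] at
   distance 2 or one at distance 2 from a coloured neighbour. *)
Definition fine s y f :=
  (forall z, orb (ker s) y z -> card (orb (stab s (orb (ker s) y) f) z) <= 3) /\
  forall z, orb (ker s) y z -> f z ->
    (exists2 t, orb (ker s) y t & ~~ f t /\ exists2 p, dom s p & E p z /\ E p t) \/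
    ((forall k, stab s (orb (ker s) y) f k -> k z = z) /\
     exists2 a, dom s a & E z a /\ near s 2 a).

Lemma paint_conj s y f l m k : good s -> outer s y -> grp s l -> grp s m ->
  cancel l m -> cancel m l ->
  ker (add s (orb (grp s) y) f) k ->
  stab s (orb (ker s) y) (fun z => f (l z)) (m \o k \o l).
Proof.
move=> gs oy sl sm lm ml [[sk fk] k0]; split; first exact: ker_conj.
move=> z /orb_ker_grp yz /=; rewrite ml; apply: fk.
exact: orb_step (good_grp gs) sl yz.
Qed.

(** Every kernel orbit in the group orbit of [y] is a translate of that of [y]. It may thus get a
    pattern of its own, which is checked on the orbit of [y] after conjugation by [l]. *)
Lemma paint_good s y f : good s -> outer s y ->
  (forall x, orb (grp s) y x -> exists2 l, grp s l &
     orb (ker s) x (l y) /\ fine s y (fun z => f (l z))) ->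
  good (add s (orb (grp s) y) f).
Proof.
move=> gs oy hl; have gg := good_grp gs; have gk := ker_group gs.
set s' := add s _ f.
have Qo x : orb (grp s) y x -> outer s x by exact: orb_outer.
have es : ext s s' by exact: add_ext.
have pull x l m : grp s m -> cancel l m -> orb (ker s) x (l y) -> orb (ker s) y (m x).
  move=> sm lm; rewrite (ker_orb_conj _ _ gs sm) lm; exact: orb_sym.
apply: add_good => //.
- by move=> g x sg; exact: orb_step.
- move=> x Qx; have [l sl [xl [f3 _]]] := hl x Qx.
  have [m sm [lm ml]] := grp_inv gg sl.
  have ymx := pull x l m sm lm xl.
  apply: leq_trans (f3 _ ymx).
  apply: (@card_inj _ _ _ m).
  + apply: fin_sub (orb_outer_fin gs oy) => z [k [[sk _] _] <-].
    by apply: orb_step => //; exact: orb_ker_grp.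
  + move=> z [k kk <-]; exists (m \o k \o l); first exact: paint_conj.
    by rewrite /= ml.
  by move=> ? ? _ _ e; exact: (can_inj ml e).
move=> x Qx fx; have [l sl [xl [_ f2]]] := hl x Qx.
have [m sm [lm ml]] := grp_inv gg sl.
have ymx := pull x l m sm lm xl.
have al := (grp_aut gg sl).2.
case: (f2 (m x) ymx); rewrite ?ml //.
  move=> [t yt [ft [p dp [pm pt]]]].
  have n2 : near s' 2 x.
    have Qt : orb (grp s) y (l t) by apply: orb_step => //; exact: orb_ker_grp.
    exists (l t); split; [by right|by rewrite /= asboolT|].
    rewrite -[x]ml; apply: (aut_ball (n := 2)) (grp_aut gg sl) _.
    by right; exists p => //; right; exists (m x) => //; exact: E_sym.
  by split=> //; apply: near_ball n2 => w; left.
(* Here the white vertex is only within distance 3, which suffices because the new kernel does not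
   move [x]. *)
move=> [fix1 [a da [ma na]]]; split.
  have := ext_near es (grp_near gs sl na).
  by apply: near_ball => w; apply: ball_cons; rewrite -[x]ml -al.
move=> [k kk kx]; case: kx; have := fix1 _ (paint_conj gs oy sl sm lm ml kk).
by rewrite /= ml => e; apply: (can_inj ml).
Qed.

End States.

(** * Colouring an orbit by classes *)

(* The orbit is cut into classes of size [q], with [nth 0 ns j] black vertices in
   class [j]; [part ns q m c] counts the vertices of colour [c] in the classes with
   [m] black vertices.  These parts bound the new orbits. *)
Definition part (ns : seq nat) q m (c : bool) :=
  sumn [seq (if c then j else q - j) | j <- ns & j == m].

(* [red n q] breaks the orbit of size [n] above which the classes lie; [std n q] has
   a different total number of black vertices, except in the [forced] cases. *)
Definition red n q : seq nat :=
  match n, q with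
  | 1, 4 => [:: 2] | 1, _ => [:: 1]
  | 2, 1 => [:: 0; 1] | 2, 2 => [:: 0; 1] | 2, 3 => [:: 0; 2] | 2, _ => [:: 1; 3]
  | _, 1 => [:: 0; 0; 1] | _, 2 => [:: 0; 1; 1] | _, 3 => [:: 1; 0; 2]
  | _, _ => [:: 1; 2; 3]
  end.

Definition std n q : seq nat :=
  match n, q with
  | 1, 4 => [:: 1] | 1, _ => [:: 0]
  | 2, 1 => [:: 0; 0] | 2, 2 => [:: 1; 1] | 2, 3 => [:: 0; 1] | 2, _ => [:: 1; 2]
  | 3, 1 => [:: 0; 0; 0] | 3, 2 => [:: 1; 1; 1]
  | _, _ => red n q
  end.

(** The last condition secures the white vertex demanded by [fine]: for q = 1 at most one vertex is
    black, and it is then fixed; otherwise every class keeps a white vertex as sibling. *)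
Definition profile n q ns :=
  [&& size ns == n, all (fun j => j <= q) ns,
      all (fun m => (part ns q m true <= 3) && (part ns q m false <= 3)) ns &
      if q == 1 then part ns q 1 true <= 1 else all (fun j => j < q) ns].

Lemma red_profile n q : 0 < n <= 3 -> 0 < q <= 4 -> profile n q (red n q).
Proof. by case: n => [|[|[|[|n]]]] //; case: q => [|[|[|[|[|q]]]]]. Qed.

Lemma std_profile n q : 0 < n <= 3 -> 0 < q <= 4 -> profile n q (std n q).
Proof. by case: n => [|[|[|[|n]]]] //; case: q => [|[|[|[|[|q]]]]]. Qed.

(** An element keeping the numbers of black vertices cannot take class 0 to class [j], so
    transitivity on the classes is lost. *)
Lemma red_split n q : 1 < n <= 3 -> 0 < q <= 4 ->
  exists2 j, j < n & nth 0 (red n q) j != nth 0 (red n q) 0.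
Proof.
by case: n => [|[|[|[|n]]]] //; case: q => [|[|[|[|[|q]]]]] // _ _;
   (exists 1 => //; done) || (exists 2 => //; done).
Qed.

(** Meant for two disjoint orbits of one colour and of size at least [n]: they lie in the same part,
    which is too small for both. *)
Lemma red_uniq n q m m' c : 1 < n <= 3 -> 0 < q <= 4 -> m \in red n q -> m' \in red n q ->
  n <= part (red n q) q m c -> n <= part (red n q) q m' c -> m = m'.
Proof.
by case: n => [|[|[|[|n]]]] //; case: q => [|[|[|[|[|q]]]]] // _ _; rewrite !inE;
   do ?[case/orP]; move=> /eqP->; do ?[case/orP]; move=> /eqP->; case: c.
Qed.

Definition forced n q := (n == 3) && (2 < q).

Lemma sum_neq n q : 0 < n <= 3 -> 0 < q <= 4 -> ~~ forced n q ->
  sumn (std n q) != sumn (red n q).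
Proof. by case: n => [|[|[|[|n]]]] //; case: q => [|[|[|[|[|q]]]]]. Qed.

Lemma std_one n : 0 < n <= 3 -> part (std n 1) 1 1 true = 0.
Proof. by case: n => [|[|[|[|n]]]]. Qed.

(** The class with one black vertex comes first and is the only one of its kind; so [y] can be made
    that vertex, and the stabilizer then fixes it. *)
Lemma forced_red n q : 0 < q <= 4 -> forced n q ->
  [/\ n = 3, 2 < q, nth 0 (red n q) 0 = 1 & part (red n q) q 1 true = 1].
Proof. by case: n => [|[|[|[|n]]]] //; case: q => [|[|[|[|[|q]]]]]. Qed.

Section Fibrations.
Variable W : world.
Notation V := (V W).
Notation E := (@E W).
Notation Ball4 := (@Ball4 W).
Notation Ball3 := (@Ball3 W).
Implicit Types (s : state W) (x y z t a b : V) (g h k : V -> V) (f : V -> bool).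

(** These are the classes of the overview, numbered by [i] and permuted by the kernel; [fib_sib]
    puts siblings within distance 2. *)
Record fib s y n q (i : V -> nat) : Prop := Fib {
  fib_n : 0 < n <= 3;
  fib_q : 0 < q <= 4;
  fib_lt : forall z, orb (ker s) y z -> i z < n;
  fib_card : forall j, j < n -> card (fun z => orb (ker s) y z /\ i z = j) = q;
  fib_eq : forall k z t, ker s k -> orb (ker s) y z -> orb (ker s) y t ->
    i z = i t -> i (k z) = i (k t);
  fib_sib : forall z t, orb (ker s) y z -> orb (ker s) y t -> i z = i t ->
    exists2 p, dom s p & E p z /\ E p t;
  fib_base : i y = 0
}.

Lemma fib_unsplit s y a : good s -> ~ dom s y -> dom s a -> E a y ->
  ~ splits (ker s) y a ->
  fib s y 1 (card (orb (ker s) y)) (fun=> 0).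
Proof.
move=> gs ny da ay nsp; have gk := ker_group gs.
have adj z : orb (ker s) y z -> E a z.
  move=> [k kk <-]; apply: contrapT => naz; apply: nsp.
  have [h kh [kh1 kh2]] := grp_inv gk kk.
  split; first by exists id; [exact: grp_id gk|exact: E_sym].
  exists h => // /E_sym; have [_ ->] := grp_aut gk kk.
  by rewrite kh2.
have nd z : orb (ker s) y z -> ~ dom s z.
  by move=> [k [sk _] <-]; exact: ndom_grp.
have oy : outer s y by split=> //; exists a.
have fO : fin (orb (ker s) y).
  by apply: fin_sub (orb_outer_fin gs oy) => z; exact: orb_ker_grp.
split=> //.
- rewrite (card_gt0 fO (orb_refl y gk)) /=.
  apply: leq_trans (outer_deg gs da); apply: card_le.
    by apply: fin_sub (E_fin a) => z [].
  by move=> z yz; split; [exact: adj|exact: nd].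
- by case=> // _; apply: card_eq => z; split=> [[]|].
by move=> z t yz yt _; exists a => //; split; exact: adj.
Qed.

(** The classes are the fibres of the map of [splits_proj]. A subgroup transitive on the orbit of
    [a] is transitive on the classes, so a pattern breaking the latter breaks the former. *)
Lemma fib_split s y a : good s -> ~ dom s y -> dom s a -> E a y ->
  splits (ker s) y a ->
  exists q i, [/\ fib s y (card (orb (ker s) a)) q i,
    1 < card (orb (ker s) a),
    forall K, is_group K -> (forall k, K k -> ker s k) ->
      (forall p, orb (ker s) a p -> orb K a p) -> forall z j, orb (ker s) y z ->
      j < card (orb (ker s) a) -> exists2 k, K k & i (k z) = j &
    forall z, orb (ker s) y z -> i z = i y -> E a z].
Proof.
move=> gs ny da ay sp; have gk := ker_group gs.
set n := card _.
have nd z : orb (ker s) y z -> ~ dom s z.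
  by move=> [k [sk _] <-]; exact: ndom_grp.
have oy : outer s y by split=> //; exists a.
have fO : fin (orb (ker s) y).
  by apply: fin_sub (orb_outer_fin gs oy) => z; exact: orb_ker_grp.
have fP := orb_dom_fin gs da.
have cP : n <= 3 by exact: good_card.
have n1 : 1 < n := splits_card_gt1 gk fP sp.
have [f [f1 f2 f3 f4]] := splits_proj gk fP cP sp.
have yy := orb_refl y gk.
(* [f y] is put first so that [y] gets class 0. *)
pose e := f y :: rem (f y) (elems (orb (ker s) a)).
have fye : f y \in elems (orb (ker s) a) by apply/(elemsP _ fP); exact: f1.
have pe := perm_to_rem fye; rewrite -/e in pe.
have se : size e = n by rewrite -(perm_size pe).
have ue : uniq e by rewrite -(perm_uniq pe) elems_uniq.
have eP p : p \in e <-> orb (ker s) a p by rewrite -(perm_mem pe); exact: elemsP.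
pose i z := index (f z) e.
have ilt z : orb (ker s) y z -> i z < n.
  by move=> yz; rewrite -se index_mem; apply/eP; exact: f1.
have ieq z t : orb (ker s) y z -> i z = i t -> f z = f t.
  move=> yz it; have fz : f z \in e by apply/eP; exact: f1.
  have ft : f t \in e by rewrite -index_mem -/(i t) -it se; exact: ilt.
  by rewrite -(nth_index (f y) fz) -/(i z) it nth_index.
have tr K : is_group K -> (forall k, K k -> ker s k) ->
  (forall p, orb (ker s) a p -> orb K a p) -> forall z j, orb (ker s) y z -> j < n ->
  exists2 k, K k & i (k z) = j.
  move=> gK sK trK z j yz jn.
  have ej : nth (f y) e j \in e by rewrite mem_nth // se.
  have af : orb K a (f z) by apply: trK; exact: f1.
  have [k Kk kf] : orb K (f z) (nth (f y) e j).
    by apply/(orb_eqv _ gK af); apply: trK; apply/eP.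
  exists k => //; rewrite /i f2 //; last exact: sK.
  by rewrite kf index_uniq // se.
pose C j z := orb (ker s) y z /\ i z = j.
have fC j : fin (C j) by apply: fin_sub fO => z [].
(* The kernel takes any class into any other, so all classes have the size of class 0. *)
have le j l : j < n -> l < n -> card (C j) <= card (C l).
  move=> jn ln; case: (pselect (exists z, C j z)) => [[z [yz iz]]|no]; last first.
    by rewrite (@card_uniq _ [::]) // => z; split=> // Cz; case: no; exists z.
  have [k kk kz] := tr _ gk (fun _ => id) (fun _ => id) z l yz ln.
  apply: (@card_inj _ _ _ k) => //; last first.
    by move=> u v _ _; exact: (aut_inj (grp_aut gk kk)).
  move=> u [yu iu]; split; first exact: orb_step.
  by rewrite -kz /i !f2 //; congr (index (k _) e); apply: ieq => //; rewrite iu.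
exists (card (C 0)), i; split=> //; last first.
  move=> z yz iz; have aa := orb_refl a gk.
  by apply: (f4 y z) => //; apply/esym/ieq.
have n0 : 0 < n by lia.
have iy0 : i y = 0 by rewrite /i /e /= eqxx.
split=> //.
- by rewrite n0 cP.
- rewrite (card_gt0 (fC 0) (x := y)) //=.
  have [r ar hr] : exists2 r, orb (ker s) a r & forall z, C 0 z -> E r z.
    have [r ar [ry _]] := f3 y y yy yy erefl.
    exists r => // z [yz iz]; apply: (f4 y z) => //.
    by apply: ieq => //; rewrite iz iy0.
  have dr : dom s r by apply: dom_orb da _ => //; exact: orb_ker_grp.
  apply: leq_trans (outer_deg gs dr); apply: card_le.
    by apply: fin_sub (E_fin r) => z [].
  by move=> z Cz; split; [exact: hr|apply: nd; case: Cz].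
- by move=> j jn; apply/eqP; rewrite eqn_leq !le.
- move=> k z t kk yz yt it; rewrite /i !f2 //.
  by rewrite (ieq z t).
move=> z t yz yt it.
have [p ap pe2] := f3 z t yz yt (ieq _ _ yz it).
by exists p => //; apply: dom_orb da _ => //; exact: orb_ker_grp.
Qed.

Lemma fib_fin s y : good s -> outer s y -> fin (orb (ker s) y).
Proof.
by move=> gs oy; apply: fin_sub (orb_outer_fin gs oy) => z; exact: orb_ker_grp.
Qed.

Definition counted s y n (i : V -> nat) ns f :=
  forall j, j < n -> card (fun z => [/\ orb (ker s) y z, i z = j & f z]) = nth 0 ns j.

Lemma color_ex s y n q i ns : good s -> outer s y -> fib s y n q i -> profile n q ns ->
  exists2 f, counted s y n i ns f & (0 < nth 0 ns 0 -> f y).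
Proof.
move=> gs oy fb /and4P[/eqP sn nq _ _].
have fO := fib_fin gs oy; have gk := ker_group gs.
pose C j z := orb (ker s) y z /\ i z = j.
have fC j : fin (C j) by apply: fin_sub fO => z [].
have ex j : exists B : V -> Prop, j < n ->
    [/\ forall z, B z -> C j z, card B = nth 0 ns j & (j = 0 -> 0 < nth 0 ns 0 -> B y)].
  case: (ltnP j n) => [jn|]; last by exists (fun=> True).
  have le : nth 0 ns j <= card (C j).
    by rewrite (fib_card fb) //; apply: (allP nq); rewrite mem_nth ?sn.
  case: (posnP (nth 0 ns j)) => [n0|n0].
    have [B BC cB] := card_subset (fC j) le.
    by exists B => _; split=> // j0; rewrite j0 in n0; rewrite n0.
  case: (posnP j) => [j0|j0].
    have Cy : C j y by split; [exact: orb_refl|rewrite j0 (fib_base fb)].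
    have [|B BC [cB By]] := card_subset_mem (n := nth 0 ns j) (fC j) Cy.
      by rewrite n0.
    by exists B.
  have [B BC cB] := card_subset (fC j) le.
  by exists B => _; split=> // jj; rewrite jj in j0.
have [B hB] := choice ex.
exists (fun z => `[< B (i z) z >]).
  move=> j jn; have [BC <- _] := hB j jn; apply: card_eq => z; split.
    by case=> _ <- /asboolP.
  by move=> Bz; have [yz iz] := BC z Bz; split=> //; apply/asboolP; rewrite iz.
move=> n0; apply/asboolP; rewrite (fib_base fb).
by have [|_ _] := hB 0; [case/andP: (fib_n fb)|apply].
Qed.

Section Counted.
Variables (s : state W) (y : V) (n q : nat) (i : V -> nat) (ns : seq nat) (f : V -> bool).
Hypotheses (gs : good s) (oy : outer s y) (fb : fib s y n q i) (pr : profile n q ns)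
  (cf : counted s y n i ns f).
Let O := orb (ker s) y.
Let fO : fin O := fib_fin gs oy.

Lemma stab_group : is_group (stab s O f).
Proof.
have gk := ker_group gs; split.
- by move=> g [/(grp_aut gk)].
- by split=> //; exact: grp_id gk.
- move=> g h [kg fg] [kh fh]; split; first exact: grp_comp.
  by move=> z yz /=; rewrite fg ?fh //; exact: orb_step.
move=> g [kg fg]; have [h kh [gh hg]] := grp_inv gk kg; exists h => //.
by split=> // z yz; rewrite -{2}[z]hg fg //; exact: orb_step.
Qed.

(** An element of the stabilizer maps classes to classes, bijectively on their black vertices. *)
Lemma stab_count k z : stab s O f k -> O z -> nth 0 ns (i (k z)) = nth 0 ns (i z).
Proof.
move=> [kk fk] yz; have gk := ker_group gs.
have [h kh [hk kh']] := grp_inv gk kk.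
have ykz : O (k z) by exact: orb_step.
have fh t : O t -> f (h t) = f t.
  by move=> yt; rewrite -fk ?kh' //; exact: orb_step.
rewrite -(cf (fib_lt fb yz)) -(cf (fib_lt fb ykz)).
have sub j : fin (fun t => [/\ O t, i t = j & f t]) by apply: fin_sub fO => t [].
apply/eqP; rewrite eqn_leq; apply/andP; split.
  apply: (@card_inj _ _ _ h) => //; last by move=> u v _ _; exact: (can_inj kh').
  move=> t [yt it ft]; split; [exact: orb_step|rewrite -[z in RHS]hk|by rewrite fh].
  exact: (fib_eq fb).
apply: (@card_inj _ _ _ k) => //; last by move=> u v _ _; exact: (can_inj hk).
move=> t [yt it ft]; split; [exact: orb_step| |by rewrite fk].
exact: (fib_eq fb).
Qed.

Lemma part_card m c :
  card (fun z => [/\ O z, f z = c & nth 0 ns (i z) = m]) <= part ns q m c.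
Proof.
have /and4P[/eqP sn nq _ _] := pr.
have fA (A : V -> Prop) : fin (fun z => O z /\ A z) by apply: fin_sub fO => z [].
have main l : l <= n ->
  card (fun z => O z /\ [/\ i z < l, f z = c & nth 0 ns (i z) = m]) <= part (take l ns) q m c.
  elim: l => [_|l IH ln]; first by rewrite (@card_uniq _ [::]) // => z; split=> // -[_ []].
  rewrite (take_nth 0) ?sn // /part filter_rcons.
  have le0 := IH (ltnW ln); rewrite /part in le0.
  set tl := [seq _ <- take l ns | _] in le0 *.
  pose B z := O z /\ [/\ i z = l, f z = c & nth 0 ns l = m].
  have : card (fun z => O z /\ [/\ i z < l.+1, f z = c & nth 0 ns (i z) = m]) <=
     card (fun z => O z /\ [/\ i z < l, f z = c & nth 0 ns (i z) = m]) + card B.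
    apply: leq_trans (card_or (fA _) (fA _)); apply: card_le.
      by apply: fin_or; exact: fA.
    move=> z [yz [iz fz mz]]; case: (ltngtP (i z) l) => h; first by left.
      by lia.
    by right; split=> //; split=> //; rewrite -h.
  move=> h; apply: leq_trans h _; case: eqP => [nm|nm]; last first.
    have -> : card B = 0 by rewrite (@card_uniq _ [::]) // => z; split=> // -[_ []].
    by rewrite addn0.
  rewrite map_rcons sumn_rcons leq_add //.
  have fc := fib_card fb ln; have cl := cf ln.
  have := card_split f (A := fun z => O z /\ i z = l) (fA _); rewrite fc.
  have -> : card (fun z => (O z /\ i z = l) /\ f z) = nth 0 ns l.
    by rewrite -cl; apply: card_eq => z; split=> [[[]]|[]].
  move=> qe; case: c {IH le0} @B => B.
    by rewrite -cl; apply: card_le; [apply: fin_sub fO => z []|move=> z [yz []]].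
  have : card B <= card (fun z => (O z /\ i z = l) /\ ~ f z).
    apply: card_le; first by apply: fin_sub fO => z [[]].
    by move=> z [yz [iz fz _]]; split=> //; rewrite fz.
  by lia.
have h := main n (leqnn n); rewrite -[X in take X]sn take_size in h; apply: leq_trans _ h.
apply: card_le; first exact: fA.
by move=> z [yz fz mz]; split=> //; split=> //; exact: (fib_lt fb).
Qed.

Lemma stab_part z t : O z -> orb (stab s O f) z t ->
  [/\ O t, f t = f z & nth 0 ns (i t) = nth 0 ns (i z)].
Proof.
move=> yz [k sk <-]; have [kk fk] := sk.
by split; [exact: orb_step (ker_group gs) _ _|exact: fk|exact: stab_count].
Qed.

Lemma stab_card z : O z -> card (orb (stab s O f) z) <= part ns q (nth 0 ns (i z)) (f z).
Proof.
move=> yz; apply: leq_trans (part_card _ _); apply: card_le.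
  by apply: fin_sub fO => t [].
by move=> t; exact: stab_part.
Qed.

Lemma part_le3 z c : O z -> part ns q (nth 0 ns (i z)) c <= 3.
Proof.
move=> yz; have /and4P[/eqP sn _ p3 _] := pr.
have : nth 0 ns (i z) \in ns by rewrite mem_nth // sn; exact: (fib_lt fb).
by move=> /(allP p3)/andP[]; case: c.
Qed.

(** For q > 1 the profile leaves a white sibling in every class. For q = 1 a black vertex is alone
    in its part, hence fixed, and the hypothesis provides a white vertex near a coloured
    neighbour. *)
Lemma counted_fine : (q = 1 -> part ns 1 1 true = 0 \/
    exists2 a, dom s a & E a y /\ near s 2 a) -> fine s y f.
Proof.
move=> hq; have gk := ker_group gs; split=> z yz.
  by apply: leq_trans (stab_card yz) _; exact: part_le3.
have /and4P[/eqP sn nq _ pq] := pr => fz.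
have iz := fib_lt fb yz; have zn : nth 0 ns (i z) \in ns by rewrite mem_nth ?sn.
case: (eqVneq q 1) => [q1|q1]; last first.
  left; rewrite (negbTE q1) in pq; have lt := allP pq _ zn.
  have fC : fin (fun t => O t /\ i t = i z) by apply: fin_sub fO => t [].
  have := card_split f fC; rewrite (fib_card fb iz).
  have -> : card (fun t => (O t /\ i t = i z) /\ f t) = nth 0 ns (i z).
    by rewrite -(cf iz); apply: card_eq => t; split=> [[[]]|[]].
  move=> qe; have /card_has[t [[yt it] /negP ft]] :
      0 < card (fun t => (O t /\ i t = i z) /\ ~ f t) by lia.
  by exists t => //; split=> //; apply: (fib_sib fb).
have nz1 : nth 0 ns (i z) = 1.
  have := allP nq _ zn; rewrite q1.
  have : 0 < nth 0 ns (i z).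
    rewrite -(cf iz); apply: (@card_gt0 _ _ z) => //.
    by apply: fin_sub fO => t [].
  by lia.
have le1 : part ns q (nth 0 ns (i z)) (f z) <= 1.
  by rewrite nz1 fz; move: pq; rewrite q1.
have c1 := leq_trans (stab_card yz) le1.
right; split.
  move=> k sk; have fS : fin (orb (stab s O f) z).
    by apply: fin_sub fO => t /(stab_part yz)[].
  apply: (card1_eq fS c1); [exact: orb_img|exact: orb_refl stab_group].
case: (hq q1) => [p0|[a da [ay na]]].
  suff : 0 < part ns q (nth 0 ns (i z)) true by rewrite nz1 q1 p0.
  rewrite -fz; apply: leq_trans (part_card _ _); apply: (@card_gt0 _ _ z) => //.
  by apply: fin_sub fO => t [].
have [k kk kz] := yz; exists (k a).
  by case: kk => sk _; exact: good_dom.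
split; last by case: kk => sk _; exact: grp_near.
by apply: E_sym; rewrite -kz; have [_ <-] := grp_aut gk kk.
Qed.

Lemma counted_sum : card (fun z => O z /\ f z) = sumn ns.
Proof.
have /and4P[/eqP sn nq _ _] := pr.
have fA (A : V -> Prop) : fin (fun z => O z /\ A z) by apply: fin_sub fO => z [].
have main l : l <= n -> card (fun z => O z /\ (i z < l /\ f z)) = sumn (take l ns).
  elim: l => [_|l IH ln]; first by rewrite take0 (@card_uniq _ [::]) // => z; split=> // -[_ []].
  rewrite (take_nth 0) ?sn // sumn_rcons -(IH (ltnW ln)) -(cf ln) -card_disj.
  - apply: card_eq => z; split.
      move=> [yz [iz fz]]; case: (ltngtP (i z) l) => h; first by left.
        by lia.
      by right.
    by case=> [[yz [iz fz]]|[yz iz fz]]; split=> //; split=> //; lia.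
  - exact: fA.
  - by apply: fin_sub fO => z [].
  by move=> z [_ [lt _]] [_ e _]; rewrite e ltnn in lt.
rewrite -[in RHS](take_size ns) sn -(main n) //; apply: card_eq => z.
by split=> [[yz fz]|[yz []]//]; split=> //; split=> //; exact: (fib_lt fb).
Qed.

End Counted.
End Fibrations.

(** * Extending a partial colouring *)

Section Extension.
Variable W : world.
Notation V := (V W).
Notation E := (@E W).
Notation Ball4 := (@Ball4 W).
Notation Ball3 := (@Ball3 W).
Implicit Types (s t : state W) (x y z a b u v : V) (g h k : V -> V) (f : V -> bool).

(** * Links from moved vertices to uncoloured ones *)

Inductive reach s u : V -> Prop :=
| reach0 : reach s u u
| reachS x v : reach s u x -> dom s v -> splits (ker s) v x -> reach s u v.

Lemma reach_dom s u x : dom s u -> reach s u x -> dom s x.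
Proof. by move=> du; case. Qed.

(** Each link is an isomorphism of orbits by [splits_iso]; so breaking the orbit of [x] breaks that
    of [u]. *)
Lemma reach_iso s u x : good s -> dom s u -> reach s u x ->
  card (orb (ker s) x) = card (orb (ker s) u) /\
  forall K, is_group K -> (forall k, K k -> ker s k) ->
    (forall z, orb (ker s) u z -> orb K u z) -> forall z, orb (ker s) x z -> orb K x z.
Proof.
move=> gs du; have gk := ker_group gs.
elim=> [|x' v ux [cx IH] dv sp]; first by split.
have dx := reach_dom du ux.
have [cv iso] := splits_iso gk (orb_dom_fin gs dx) (good_card gs dx)
  (orb_dom_fin gs dv) (good_card gs dv) sp.
by split=> [|K gK sK tr]; [rewrite cv|apply: iso => //; exact: IH].
Qed.

Lemma splits_grp s g y x : good s -> grp s g -> splits (ker s) y x ->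
  splits (ker s) (g y) (g x).
Proof.
move=> gs sg [[k kk yk] [l kl yl]].
have [h sh [gh hg]] := grp_inv (good_grp gs) sg.
have [_ ag] := grp_aut (good_grp gs) sg.
split.
  exists (g \o k \o h); first exact: (ker_conj gs sh sg hg).
  by rewrite /= gh -ag.
exists (g \o l \o h); first exact: (ker_conj gs sh sg hg).
by rewrite /= gh -ag.
Qed.

Lemma moved_grp s g x : good s -> grp s g -> moved s (g x) -> moved s x.
Proof.
move=> gs sg [k kk kx]; have [h sh [gh hg]] := grp_inv (good_grp gs) sg.
exists (h \o k \o g); first exact: ker_conj.
by move=> /= e; apply: kx; apply: (can_inj hg); rewrite e gh.
Qed.

Lemma splits_moved s y a : splits (ker s) y a -> moved s a.
Proof.
move=> [[k kk yk] [l kl yl]]; apply: contrapT => nm.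
have e m : ker s m -> m a = a.
  by move=> km; apply: contrapT => mz; apply: nm; exists m.
by apply: yl; rewrite e // -[a](e k).
Qed.

Lemma unsplit s y x k : good s -> ~ splits (ker s) y x -> ker s k -> E x y -> E (k x) y.
Proof.
move=> gs ns kk xy; apply: contrapT => nkx; apply: ns; split.
  by exists id; [exact: grp_id (ker_group gs)|exact: E_sym].
by exists k => // /E_sym.
Qed.

Lemma unsplit_iff s y x k : good s -> ~ splits (ker s) y x -> ker s k -> E x y <-> E (k x) y.
Proof.
move=> gs ns kk; have gk := ker_group gs; split; first exact: (unsplit gs ns kk).
have [h kh [kh1 hk]] := grp_inv gk kk.
move=> kxy; rewrite -[x]kh1; apply: (unsplit gs _ kh kxy) => sp; apply: ns.
by apply: (splits_orb gk sp (orb_refl y gk)); exists h; rewrite ?kh1.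
Qed.

(** Otherwise the coloured vertices linked to [u], up to the kernel, are split by no vertex outside,
    and [patch] makes the kernel fix [u]. *)
Lemma reach_out s u : good s -> dom s u -> moved s u ->
  exists x y, [/\ reach s u x, ~ dom s y & splits (ker s) y x].
Proof.
move=> gs du [k0 kk0 k0u]; apply: contrapT => no; apply: k0u.
have gk := ker_group gs.
pose S x := dom s x /\ exists2 k, ker s k & reach s u (k x).
have Su : S u by split=> //; exists id; [exact: grp_id gk|exact: reach0].
apply: (patch gk kk0 (S := S)) => //.
- by apply: fin_sub (good_fin gs) => x [].
- move=> h x _ kh [dx [k kk uk]]; split; first by case: kh => sh _; exact: good_dom.
  have [h' kh' [hh' _]] := grp_inv gk kh.
  by exists (k \o h'); [exact: grp_comp|rewrite /= hh'].
move=> x y [dx [k kk uk]] nSy; apply: (unsplit_iff gs _ kk0) => sp.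
have [sk _] := kk.
have spk := splits_grp gs sk sp.
case: (pselect (dom s y)) => dy; last first.
  by apply: no; exists (k x), (k y); split=> //; exact: ndom_grp.
by apply: nSy; split=> //; exists k => //; apply: reachS spk => //; exact: good_dom.
Qed.

Definition violator s u := [/\ dom s u, moved s u &
  exists2 g, grp s g & ~ orb (ker s) u (g u)].

(** If neither case occurs, [patch] applies to [g] on the set of coloured vertices that are unmoved
    or linked, up to the group, to a violator. This set contains [Ball4], so [g] lies in the
    kernel. *)
Lemma reach_violator s g : good s -> grp s g -> ~ ker s g ->
  (exists u x y, [/\ violator s u, reach s u x, ~ dom s y & splits (ker s) y x]) \/
  (exists y a h, [/\ ~ dom s y, dom s a, E a y, ~ splits (ker s) y a &
     grp s h /\ ~ orb (ker s) y (h y)]).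
Proof.
move=> gs sg nk; apply: contrapT => /not_orP[no1 no2]; apply: nk; split=> //.
have gg := good_grp gs; have gk := ker_group gs.
pose S x := dom s x /\ (~ moved s x \/
  exists2 h, grp s h & exists2 u, violator s u & reach s u (h x)).
move=> x x0; apply: (patch gg sg (S := S)) => //; first 1 last.
- move=> h z _ sh [dz Sz]; split; first exact: good_dom.
  have [h' sh' [hh' _]] := grp_inv gg sh.
  case: Sz => [nm|[l sl ulz]]; first by left => /(moved_grp gs sh).
  by right; exists (l \o h'); [exact: grp_comp|rewrite /= hh'].
- move=> {x x0} x y [dx Sx] nSy.
  have nsp z : S z -> ~ splits (ker s) y z.
    move=> [dz [nm|[h sh [u vu uh]]]] sp; first exact: nm (splits_moved sp).
    have sph := splits_grp gs sh sp.
    case: (pselect (dom s y)) => dy; last first.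
      by apply: no1; exists u, (h z), (h y); split=> //; exact: ndom_grp.
    apply: nSy; split=> //; right; exists h => //; exists u => //.
    by apply: reachS sph => //; exact: good_dom.
  (* A coloured [y] outside [S] is moved and no violator; an uncoloured one falls under the second
     case. *)
  have Ky z h : S z -> E z y -> grp s h -> orb (ker s) y (h y).
    move=> Sz zy sh; case: (pselect (dom s y)) => dy.
      have my : moved s y by apply: contrapT => nm; apply: nSy; split=> //; left.
      apply: contrapT => nh; apply: nSy; split=> //; right; exists id.
        exact: grp_id gg.
      by exists y; [split=> //; exists h|exact: reach0].
    apply: contrapT => nh; apply: no2; exists y, z, h; split=> //; last exact: nsp.
    by case: Sz.
  have [h sh [gh hg]] := grp_inv gg sg.
  have [_ ag] := grp_aut gg sg.
  have Sgx : S (g x).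
    split; first exact: good_dom.
    case: Sx => [nm|[l sl ulz]]; first by left => /(moved_grp gs sg).
    by right; exists (l \o h); [exact: grp_comp|rewrite /= gh].
  have key : orb (ker s) y (h y) -> E x y <-> E (g x) y.
    move=> [k kk ky]; have [m km [mk km']] := grp_inv gk kk.
    have [_ ak] := grp_aut gk kk.
    have e1 : E (g x) y <-> E x (k y) by rewrite ky (ag x) hg.
    have eq : E (m x) y <-> E x (k y) by rewrite (ak (m x)) km'.
    have us := unsplit_iff gs (nsp x (conj dx Sx)) km.
    by split=> [/us/eq/e1|/e1/eq/us].
  split=> xy; first by apply/key => //; apply: (Ky x).
  by apply/key => //; apply: (Ky (g x)).
- split; first exact: (good_Ball4 gs).
  by left=> -[k [_ k0]]; rewrite k0.
by apply: fin_sub (good_fin gs) => z [].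
Qed.

(** Group elements agreeing on [Ball4] form a coset of the kernel; the state [t] has lost the whole
    coset of [g]. *)
Definition progress s t := [/\ good t, ext s t &
  exists2 g, grp s g & forall h, grp t h -> ~ forall x, Ball4 x -> h x = g x].

Lemma progress_ext s t (r : state W) : ext s t -> progress t r -> progress s r.
Proof.
move=> st [gr tr [g tg hg]]; split=> //; first exact: ext_trans tr.
by exists g => //; case: st => _ _; apply.
Qed.

Lemma fine_eq s y f f' : (forall z, orb (ker s) y z -> f z = f' z) ->
  good s -> fine s y f -> fine s y f'.
Proof.
move=> e gs [f3 f2]; have gk := ker_group gs.
have st : stab s (orb (ker s) y) f = stab s (orb (ker s) y) f'.
  apply/funext => k; apply/propext; split=> -[kk fk]; split=> // z yz.
    by rewrite -!e ?fk //; exact: orb_step.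
  by rewrite !e ?fk //; exact: orb_step.
split; rewrite -st // => z yz; rewrite -e // => /(f2 z yz)[[t yt [ft p]]|h]; last by right.
by left; exists t => //; rewrite -e.
Qed.

Lemma paint_ex s y (R : (V -> Prop) -> (V -> V) -> (V -> bool) -> Prop) :
  good s -> outer s y ->
  (forall x, orb (grp s) y x -> exists l f, [/\ grp s l, orb (ker s) x (l y),
     fine s y f & R (orb (ker s) x) l f]) ->
  exists f, good (add s (orb (grp s) y) f) /\
   forall x, orb (grp s) y x -> exists l f', [/\ grp s l, orb (ker s) x (l y),
     fine s y f', R (orb (ker s) x) l f' & forall z, orb (ker s) y z -> f (l z) = f' z].
Proof.
move=> gs oy ex; have gg := good_grp gs; have gk := ker_group gs.
pose P X (p : (V -> V) * (V -> V) * (V -> bool)) := let: (l, m, f) := p in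
  [/\ grp s l, cancel l m, X (l y), fine s y f & R X l f].
(* The choice is indexed by the orbit as a predicate, so that all its vertices use the same [l] and
   the same pattern. *)
have exF X : exists p, (exists2 x, orb (grp s) y x & X = orb (ker s) x) -> P X p.
  case: (pselect (exists2 x, orb (grp s) y x & X = orb (ker s) x)) => [[x yx ->]|no]; last first.
    by exists (id, id, xpredT).
  have [l [f [sl xl ff Rf]]] := ex x yx.
  by have [m sm [lm _]] := grp_inv gg sl; exists (l, m, f).
have [F hF] := choice exF.
pose f x := let: (l, m, f) := F (orb (ker s) x) in f (m x).
have hf x : orb (grp s) y x -> exists l f', [/\ grp s l, orb (ker s) x (l y),
     fine s y f', R (orb (ker s) x) l f' & forall z, orb (ker s) y z -> f (l z) = f' z].
  move=> yx; have := hF (orb (ker s) x) (ex_intro2 _ _ x yx erefl).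
  rewrite /P; case FX : (F (orb (ker s) x)) => [[l m] f'] [sl lm xl ff Rf].
  exists l, f'; split=> // z yz.
  rewrite /f.
  have -> : orb (ker s) (l z) = orb (ker s) x; last by rewrite FX lm.
  apply/funext => w; apply/propext.
  have xlz : orb (ker s) x (l z).
    exact: orb_trans gk xl ((ker_orb_conj y z gs sl).1 yz).
  by split=> /(orb_eqv _ gk xlz).
exists f; split=> //; apply: paint_good => // x yx.
have [l [f' [sl xl ff _ e]]] := hf x yx.
by exists l => //; split=> //; apply: fine_eq ff => // z yz; rewrite e.
Qed.

Lemma card_orb_grp s y x l f f' : good s -> outer s y -> grp s l ->
  orb (ker s) x (l y) ->
  (forall z, orb (ker s) y z -> f (l z) = f' z) ->
  card (fun z => orb (ker s) x z /\ f z) = card (fun z => orb (ker s) y z /\ f' z).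
Proof.
move=> gs oy sl xl e; have gk := ker_group gs.
have [m sm [lm ml]] := grp_inv (good_grp gs) sl.
have fO : fin (orb (ker s) y) := fib_fin gs oy.
have to z : orb (ker s) x z -> orb (ker s) y (m z).
  move=> /(orb_eqv _ gk xl); rewrite (ker_orb_conj _ _ gs sm) lm => h.
  exact: h.
have from z : orb (ker s) y z -> orb (ker s) x (l z).
  by move=> yz; exact: orb_trans gk xl ((ker_orb_conj y z gs sl).1 yz).
have fX : fin (orb (ker s) x).
  have ox : outer s x.
    apply: orb_outer (outer_grp gs sl oy) _ => //.
    by apply: orb_ker_grp; exact: orb_sym.
  exact: fib_fin.
apply/eqP; rewrite eqn_leq; apply/andP; split.
  apply: (@card_inj _ _ _ m).
  - by apply: fin_sub fO => z [].
  - by move=> z [xz fz]; split; [exact: to|rewrite -e ?ml //; exact: to].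
  by move=> ? ? _ _; exact: (can_inj ml).
apply: (@card_inj _ _ _ l).
- by apply: fin_sub fX => z [].
- by move=> z [yz fz]; split; [exact: from|rewrite e].
by move=> ? ? _ _; exact: (can_inj lm).
Qed.

(** The orbit of [y] gets [red], the other kernel orbits in its group orbit get [std]. The totals
    differ, so nothing in the coset of [h] can take the orbit of [y] to that of [h y]. *)
Lemma kill_unforced s y a n q i h : good s -> ~ dom s y -> dom s a -> E a y ->
  fib s y n q i -> ~~ forced n q -> (q = 1 -> near s 2 a) ->
  grp s h -> ~ orb (ker s) y (h y) -> exists t, progress s t.
Proof.
move=> gs ny da ay fb nf na sh nhy.
have oy : outer s y by split=> //; exists a.
have gg := good_grp gs; have gk := ker_group gs.
have n3 := fib_n fb; have q4 := fib_q fb.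
have pr := red_profile n3 q4; have ps := std_profile n3 q4.
have [fr cr _] := color_ex gs oy fb pr.
have [fs cs _] := color_ex gs oy fb ps.
have hq ns : q = 1 -> part ns 1 1 true = 0 \/ exists2 a, dom s a & E a y /\ near s 2 a.
  by move=> q1; right; exists a => //; split=> //; exact: na.
have ffr := counted_fine gs oy fb pr cr (hq _).
have ffs := counted_fine gs oy fb ps cs (hq _).
pose R X (l : V -> V) f := card (fun z => orb (ker s) y z /\ f z) =
  if `[< X = orb (ker s) y >] then sumn (red n q) else sumn (std n q).
have [|f [gt hf]] := @paint_ex s y R gs oy.
  move=> x [l sl <-]; exists l.
  case: (pselect (orb (ker s) (l y) = orb (ker s) y)) => e.
    exists fr; split=> //; first exact: orb_refl.
    by rewrite /R asboolT // (counted_sum gs oy fb pr cr).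
  exists fs; split=> //; first exact: orb_refl.
  by rewrite /R asboolF // (counted_sum gs oy fb ps cs).
set t := add s _ f in gt.
have est : ext s t by apply: add_ext => x; exact: orb_outer.
exists t; split=> //; exists h => // h' th' hh'.
have [sh' fh'] := th'.
have [m sm [hm mh]] := grp_inv gg sh.
have khy : orb (ker s) (h y) (h' y).
  have -> : h' y = h (m (h' y)) by rewrite mh.
  apply: (ker_orb_conj y (m (h' y)) gs sh).1; exists (m \o h') => //; split; first exact: grp_comp.
  by move=> x x0 /=; rewrite hh' // hm.
have cnt x : orb (grp s) y x -> card (fun z => orb (ker s) x z /\ f z) =
  if `[< orb (ker s) x = orb (ker s) y >] then sumn (red n q) else sumn (std n q).
  move=> yx; have [l [f' [sl xl _ <- e]]] := hf x yx.
  exact: card_orb_grp e.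
have yy : orb (grp s) y y by exact: orb_refl.
have yhy : orb (grp s) y (h' y) by exact: orb_img.
have := sum_neq n3 q4 nf; apply/negP; rewrite negbK; apply/eqP.
have := cnt _ yy; rewrite asboolT // => <-; have := cnt _ yhy.
rewrite asboolF => [<-|e]; last first.
  have : orb (ker s) (h' y) y by rewrite e; exact: orb_refl.
  by move/(orb_trans gk khy)/(orb_sym gk) => /nhy.
apply: (card_orb_grp gs oy sh' (orb_refl _ gk)) => z yz.
by apply: fh'; exact: orb_ker_grp.
Qed.

(** The kernel orbit of [y] is a whole group orbit, so it can be coloured by [red] alone, and the
    new kernel is no longer transitive on the classes. *)
Lemma reduce_step s y a : good s -> ~ dom s y -> dom s a -> E a y ->
  splits (ker s) y a -> (forall h, grp s h -> orb (ker s) y (h y)) ->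
  exists t, [/\ good t, ext s t,
    ~ (forall z, orb (ker s) a z -> orb (ker t) a z),
    forall x, dom t x <-> dom s x \/ orb (ker s) y x &
    forall x, orb (ker s) y x -> violator t x -> card (orb (ker t) x) < card (orb (ker s) a)].
Proof.
move=> gs ny da ay sp Ly; have gk := ker_group gs.
have oy : outer s y by split=> //; exists a.
have [q [i [fb n1 tr _]]] := fib_split gs ny da ay sp.
set n := card _ in fb n1 tr *.
have n3 := fib_n fb; have q4 := fib_q fb.
have n13 : 1 < n <= 3 by lia.
have pr := red_profile n3 q4.
have [f cf _] := color_ex gs oy fb pr.
have na : q = 1 -> part (red n q) 1 1 true = 0 \/ exists2 a, dom s a & E a y /\ near s 2 a.
  move=> _; right; exists a => //; split=> //; apply: moved_near => //.
  exact: splits_moved sp.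
have ff := counted_fine gs oy fb pr cf na.
have LK x : orb (grp s) y x <-> orb (ker s) y x.
  by split=> [[h sh <-]|/orb_ker_grp//]; exact: Ly.
pose t := add s (orb (grp s) y) f.
have est : ext s t by apply: add_ext => x; exact: orb_outer.
have gt : good t.
  apply: paint_good => // x /LK yx; exists id; first exact: grp_id (good_grp gs).
  by split=> //; exact: orb_sym.
have gkt := ker_group gt.
have kst k : ker t k -> stab s (orb (ker s) y) f k.
  by move=> [[sk fk] k0]; split=> // z /LK; exact: fk.
have kts k : ker t k -> ker s k by move=> /kst[].
exists t; split=> //.
- move=> tra; have [j jn jne] := red_split n13 q4.
  have [k tk ik] := tr _ gkt kts tra y j (orb_refl y gk) jn.
  have [] := stab_part gs oy fb cf (orb_refl y gk) (orb_img y (kst k tk)).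
  by rewrite ik (fib_base fb) => _ _ /eqP; rewrite (negbTE jne).
- by move=> x; split=> [[dx|/LK]|[dx|/LK]]; by [left|right].
(* The new orbits of [x] and [h x] are disjoint, of one colour and one size. If that size were at
   least [n], [red_uniq] would put both into one part, of size at most 3. *)
move=> x yx [dx [k0 tk0 k0x] [h th nhx]]; rewrite ltnNge; apply/negP => le.
have [sh fh] := th.
have yhx : orb (ker s) y (h x) by apply/LK; apply: orb_step => //; [exact: good_grp|apply/LK].
have fhx : f (h x) = f x by apply: fh; apply/LK.
have fO := fib_fin gs oy.
pose P m c z := [/\ orb (ker s) y z, f z = c & nth 0 (red n q) (i z) = m].
have fP m c : fin (P m c) by apply: fin_sub fO => z [].
have sub z w : orb (ker s) y z -> orb (ker t) z w -> P (nth 0 (red n q) (i z)) (f z) w.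
  by move=> yz [k /kst kk <-]; apply: (stab_part gs oy fb cf) => //; exact: orb_img.
have fo z : orb (ker s) y z -> fin (orb (ker t) z).
  by move=> yz; apply: fin_sub (fP _ _) => w; exact: sub.
have ch : card (orb (ker t) (h x)) = card (orb (ker t) x).
  have := @card_orb_grp t x (h x) h xpredT xpredT; rewrite /=.
  have [m tm [hm mh]] := grp_inv (good_grp gt) th.
  move=> _; apply/eqP; rewrite eqn_leq; apply/andP; split.
    apply: (@card_inj _ _ _ m); [exact: fo| |by move=> ? ? _ _; exact: (can_inj mh)].
    by move=> z; rewrite (ker_orb_conj _ _ gt tm) hm.
  apply: (@card_inj _ _ _ h); [exact: fo| |by move=> ? ? _ _; exact: (can_inj hm)].
  by move=> z; rewrite (ker_orb_conj _ _ gt th).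
have mem z : orb (ker s) y z -> nth 0 (red n q) (i z) \in red n q.
  by move=> yz; rewrite mem_nth //; have /and4P[/eqP-> _ _ _] := pr; exact: (fib_lt fb).
have up z : orb (ker s) y z ->
    card (orb (ker t) z) <= part (red n q) q (nth 0 (red n q) (i z)) (f z).
  move=> yz; apply: leq_trans (part_card gs oy fb pr cf _ _).
  by apply: card_le (fP _ _) _ => w; exact: sub.
have em : nth 0 (red n q) (i x) = nth 0 (red n q) (i (h x)).
  apply: (red_uniq n13 q4 (c := f x)); [exact: mem|exact: mem| |].
    exact: leq_trans le (up _ yx).
  by rewrite -fhx; apply: leq_trans (up _ yhx); rewrite ch.
have := part_le3 fb pr (f x) yx.
have := card_disj (fo _ yx) (fo _ yhx) _; rewrite ch => cd.
have : card (fun w => orb (ker t) x w \/ orb (ker t) (h x) w) <=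
    card (P (nth 0 (red n q) (i x)) (f x)).
  apply: card_le (fP _ _) _ => w [|]; first exact: sub.
  by rewrite em -fhx; exact: sub.
rewrite cd; last first.
  move=> w xw hxw; apply: nhx; apply: orb_trans xw _ => //; exact: orb_sym.
have := part_card gs oy fb pr cf (nth 0 (red n q) (i x)) (f x).
rewrite -/(P _ _); lia.
Qed.

Lemma stab_fixed s y n q i ns f : good s -> outer s y -> fib s y n q i ->
  profile n q ns -> counted s y n i ns f -> part ns q (nth 0 ns 0) true = 1 -> f y ->
  forall k, stab s (orb (ker s) y) f k -> k y = y.
Proof.
move=> gs oy fb pr cf p1 fy k sk; have yy := orb_refl y (ker_group gs).
have := stab_card gs oy fb pr cf yy; rewrite (fib_base fb) fy p1 => c1.
apply: (card1_eq _ c1); [|exact: orb_img|exact: orb_refl (stab_group y f gs)].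
by apply: fin_sub (fib_fin gs oy) => z /(stab_part gs oy fb cf yy)[].
Qed.

Lemma fib_size3 s y q i : good s -> outer s y -> fib s y 3 q i ->
  card (orb (ker s) y) = 3 * q.
Proof.
move=> gs oy fb; have fO := fib_fin gs oy.
have fA (A : V -> Prop) : fin (fun z => orb (ker s) y z /\ A z).
  by apply: fin_sub fO => z [].
have -> : card (orb (ker s) y) =
  card (fun z => (orb (ker s) y z /\ i z = 0) \/
     ((orb (ker s) y z /\ i z = 1) \/ (orb (ker s) y z /\ i z = 2))).
  apply: card_eq => z; split=> [yz|[[]|[[]|[]]]//].
  have := fib_lt fb yz; case e : (i z) => [|[|[|//]]] _; [by left|by right; left|by right; right].
rewrite !card_disj ?(fib_card fb) //; first lia.
- by move=> z [_ ->] [].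
- exact: fin_or.
by move=> z [_ ->] [[]|[]].
Qed.

(* [l0] is chosen with [z] not adjacent to [l0 y]; the colouring makes the kernel fix
   [y] and [l0 y].  An [h] in the class of [l0] that survives maps [y] to [l0 y], so
   it cannot keep the new orbit of [z], which lies over the single vertex [y], and
   [kill_unforced] applies to [z]. *)
Lemma kill_forced s y n q i g z : good s -> outer s y -> fib s y n q i -> forced n q ->
  grp s g -> ~ orb (ker s) y (g y) -> E y z -> ~ dom s z -> ~ orb (grp s) y z ->
  exists t, progress s t.
Proof.
move=> gs oy fb fo sg ngy yz nz nLz; have gg := good_grp gs; have gk := ker_group gs.
have fO := fib_fin gs oy.
have [n3 q2 r1 p1] := forced_red (fib_q fb) fo.
(* The translate by [g] of the orbit of [y] has 3q >= 9 vertices, more than [z] has neighbours. *)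
have [l0 [sl nl nlz]] : exists l, [/\ grp s l, ~ orb (ker s) y (l y) & ~ E z (l y)].
  apply: contrapT => no.
  have c9 : 9 <= card (orb (ker s) y).
    by rewrite n3 in fb; rewrite (fib_size3 gs oy fb); lia.
  suff : card (orb (ker s) y) <= card (E z) by have := E_card z; lia.
  apply: (@card_inj _ _ _ g); first exact: E_fin.
    move=> _ [k kk <-]; apply: contrapT => nE; apply: no; exists (g \o k); split=> //=.
      by apply: (grp_comp gg) => //; case: kk.
    move=> yk; apply: ngy.
    apply: (orb_trans gk yk); apply: (orb_sym gk).
    by apply: (ker_orb_conj y (k y) gs sg).1; exact: orb_img.
  by move=> ? ? _ _; exact: (aut_inj (grp_aut gg sg)).
have [m sm [lm ml]] := grp_inv gg sl.
have pr := red_profile (fib_n fb) (fib_q fb).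
have [f1 cf] := color_ex gs oy fb pr; rewrite r1 => /(_ isT) f1y.
have ff := counted_fine gs oy fb pr cf.
have {ff} ff : fine s y f1 by apply: ff => q1; rewrite q1 in q2.
have sfix k : stab s (orb (ker s) y) f1 k -> k y = y.
  by apply: (stab_fixed gs oy fb pr cf) => //; rewrite r1.
(* The translating map is prescribed on the orbits of [y] and [l0 y], so that the vertices singled
   out there are [y] and [l0 y] themselves. *)
pose R (X : V -> Prop) l f := [/\ f = f1, X y -> l = id & X (l0 y) -> l = l0].
have [|f [gt hf]] := @paint_ex s y R gs oy.
  move=> x yx; case: (pselect (orb (ker s) x y)) => xy.
    exists id, f1; split=> //; first exact: grp_id gg.
    split=> // xl; case: nl; apply: orb_trans xl => //; exact: orb_sym.
  case: (pselect (orb (ker s) x (l0 y))) => xl; first by exists l0, f1.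
  by case: yx => [l sl' lx]; exists l, f1; split=> //; rewrite lx; exact: orb_refl.
set t := add s _ f in gt.
have est : ext s t by apply: add_ext => x; exact: orb_outer.
have fO1 z' : orb (ker s) y z' -> f z' = f1 z'.
  have [l [f' [_ _ _ [-> li _] e]]] := hf y (orb_refl y gg).
  by rewrite li // in e; [exact: e|exact: orb_refl].
have fO2 z' : orb (ker s) y z' -> f (l0 z') = f1 z'.
  have [l [f' [_ _ _ [-> _ li] e]]] := hf (l0 y) (orb_img y sl).
  by rewrite li // in e; [exact: e|exact: orb_refl].
have ty k : ker t k -> k y = y.
  move=> tk; apply: sfix; have [kk fk] := paint_conj gs oy (grp_id gg) (grp_id gg)
    (fun _ => erefl) (fun _ => erefl) tk; split=> // w yw.
  have := fk w yw; rewrite /= => e; rewrite -!fO1 //; exact: orb_step.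
have tl k : ker t k -> k (l0 y) = l0 y.
  move=> tk; have [kk fk] := paint_conj gs oy sl sm lm ml tk.
  apply: (can_inj ml); rewrite lm; apply: (sfix (m \o k \o l0)); split=> // w yw.
  have := fk w yw; rewrite /= => e; rewrite -!fO2 //; exact: (orb_step gk kk yw).
case: (pselect (exists2 h, grp t h & forall x, Ball4 x -> h x = l0 x)) => [[h th hl]|no]; last first.
  by exists t; split=> //; exists l0 => // h th hl; apply: no; exists h.
have [sh fh] := th.
have hy : h y = l0 y.
  rewrite -[h y]ml; congr l0; apply: (sfix (m \o h)); split.
    by split=> [|x x0 /=]; [exact: grp_comp|rewrite hl].
  move=> w yw; rewrite -fO2 /= ?ml ?fh ?fO1 //; first exact: orb_ker_grp.
  apply: (orb_step gk (g := m \o h)) => //; split=> [|x x0 /=]; first exact: grp_comp.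
  by rewrite hl.
have nhz : ~ orb (ker t) z (h z).
  move=> [k tk kz]; apply: nlz; apply: E_sym.
  have [_ ak] := grp_aut (ker_group gt) tk.
  apply: (ak _ _).2; rewrite tl // kz -hy.
  by have [_ <-] := grp_aut gg sh.
have dty : dom t y by right; exact: orb_refl.
have ntz : ~ dom t z by case.
have nsp : ~ splits (ker t) z y.
  by move=> [_ [k tk]]; case; rewrite ty //; exact: E_sym.
have [||r pt] := kill_unforced gt ntz dty yz (fib_unsplit gt ntz dty yz nsp) _ _ th nhz; first by [].
  move=> _.
  (* The class of [y] has q > 2 vertices and a single black one, so [y] has a white sibling. *)
  have n0 : 0 < n by rewrite n3.
  have fA (A : V -> Prop) : fin (fun z => orb (ker s) y z /\ A z).
    by apply: fin_sub fO => w [].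
  have fC : fin (fun w => orb (ker s) y w /\ i w = 0) by [].
  have := card_split f1 fC; rewrite (fib_card fb n0).
  have -> : card (fun w => (orb (ker s) y w /\ i w = 0) /\ f1 w) = 1.
    by rewrite -r1 -(cf 0 n0); apply: card_eq => w; split=> [[[]]|[]].
  move=> qe; have /card_has[w [[yw iw] /negP fw]] :
      0 < card (fun w => (orb (ker s) y w /\ i w = 0) /\ ~ f1 w) by lia.
  have [|p dp [py pw]] := fib_sib fb (orb_refl y gk) yw; first by rewrite (fib_base fb).
  exists w; split; first by right; exact: orb_ker_grp.
    by rewrite /= asboolT ?fO1 //; exact: orb_ker_grp.
  by right; exists p => //; right; exists y => //; exact: E_sym.
by exists r; exact: progress_ext pt.
Qed.

(** * The termination measure *)

Definition violator3 s u := violator s u /\ card (orb (ker s) u) = 3.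

Definition open3 s u := violator3 s u /\ exists2 z, ~ dom s z & E u z.

Lemma violator_fin s : good s -> fin (violator s).
Proof. by move=> gs; apply: fin_sub (good_fin gs) => u []. Qed.

Lemma violator3_fin s : good s -> fin (violator3 s).
Proof. by move=> gs; apply: fin_sub (violator_fin gs) => u []. Qed.

Lemma open3_fin s : good s -> fin (open3 s).
Proof. by move=> gs; apply: fin_sub (violator3_fin gs) => u []. Qed.

Lemma moved_card s x : good s -> dom s x -> moved s x -> 1 < card (orb (ker s) x).
Proof.
move=> gs dx [k kk kx]; rewrite ltnNge; apply/negP => c1; apply: kx.
apply: (card1_eq (orb_dom_fin gs dx) c1); first exact: orb_img.
exact: orb_refl (ker_group gs).
Qed.

Lemma ext_orb s t x y : ext s t -> orb (ker t) x y -> orb (ker s) x y.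
Proof. by move=> st [k tk <-]; exists k => //; exact: ext_ker tk. Qed.

Lemma card_orb_ext s t x : good s -> ext s t -> dom s x ->
  card (orb (ker t) x) <= card (orb (ker s) x).
Proof.
by move=> gs st dx; apply: card_le (orb_dom_fin gs dx) _ => y; exact: ext_orb.
Qed.

(** If [g x] were in the old orbit of [x], that orbit of size at most 3 would contain two disjoint
    new orbits of size at least 2. *)
Lemma violator_ext s t x : good s -> good t -> ext s t -> dom s x -> violator t x -> violator s x.
Proof.
move=> gs gt st dx [dtx mx [g tg ngx]]; have gk := ker_group gt.
have sg : grp s g by case: st => _ _; apply.
split=> //; first exact: ext_moved mx.
exists g => // sgx.
have [_ dom_st _] := st; have dgx : dom s (g x) by exact: good_dom.
have dtgx : dom t (g x) by exact: good_dom.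
have mgx : moved t (g x).
  have [h th [gh hg]] := grp_inv (good_grp gt) tg.
  by apply: (moved_grp gt th); rewrite gh.
have c1 := moved_card gt dtx mx; have c2 := moved_card gt dtgx mgx.
have c3 := good_card gs dx.
suff : card (orb (ker t) x) + card (orb (ker t) (g x)) <= card (orb (ker s) x) by lia.
rewrite -card_disj; [|exact: orb_dom_fin|exact: orb_dom_fin|].
  apply: card_le (orb_dom_fin gs dx) _ => y [] h; first exact: ext_orb h.
  by apply: orb_trans sgx (ext_orb st h); exact: ker_group.
by move=> y xy gy; apply: ngx; apply: (orb_trans gk xy); exact: orb_sym.
Qed.

Lemma violator3_ext s t x : good s -> good t -> ext s t -> dom s x -> violator3 t x -> violator3 s x.
Proof.
move=> gs gt st dx [vx cx]; split; first exact: violator_ext vx.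
by have := card_orb_ext gs st dx; have := good_card gs dx; lia.
Qed.

Lemma open3_ext s t x : good s -> good t -> ext s t -> dom s x -> open3 t x -> open3 s x.
Proof.
move=> gs gt st dx [vx [z nz xz]]; split; first exact: violator3_ext vx.
by exists z => // dz; apply: nz; case: st => + _ _; apply.
Qed.

(** [open3] comes first because [dead_end] lowers it while possibly creating violators;
    [reduce_lower] lowers one of the other two. *)
Definition lower t s := [|| card (open3 t) < card (open3 s),
  (card (open3 t) <= card (open3 s)) && (card (violator3 t) < card (violator3 s)) |
  [&& card (open3 t) <= card (open3 s), card (violator3 t) <= card (violator3 s) &
      card (violator t) < card (violator s)]].

(* If [g a] were in the orbit of [a], then [a] would have [q] uncoloured neighbours in
   each of two disjoint orbits; so [a] is a violator, and colouring breaks its orbit,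
   whereas the new vertices have no uncoloured neighbour. *)
Lemma dead_end s y a q i g : good s -> ~ dom s y -> dom s a -> E a y ->
  splits (ker s) y a -> card (orb (ker s) a) = 3 -> fib s y 3 q i -> 2 < q ->
  (forall K, is_group K -> (forall k, K k -> ker s k) ->
      (forall p, orb (ker s) a p -> orb K a p) -> forall z j, orb (ker s) y z ->
      j < 3 -> exists2 k, K k & i (k z) = j) ->
  (forall z, orb (ker s) y z -> i z = i y -> E a z) ->
  grp s g -> ~ orb (ker s) y (g y) ->
  (forall b z, orb (ker s) y b -> E b z -> ~ dom s z -> orb (grp s) y z) ->
  exists t, [/\ good t, ext s t & lower t s].
Proof.
move=> gs ny da ay sp ca fb q2 tr adj sg ngy dead.
have gk := ker_group gs; have gg := good_grp gs.
have oy : outer s y by split=> //; exists a.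
have q4 := fib_q fb.
have fo : forced 3 q by rewrite /forced q2.
have pr := red_profile (n := 3) isT q4.
have [f1 cf _] := color_ex gs oy fb pr.
have ff : fine s y f1 by apply: (counted_fine gs oy fb pr cf) => q1; rewrite q1 in q2.
pose R (X : V -> Prop) (l : V -> V) f := f = f1 /\ (X y -> l = id).
have [|f [gt hf]] := @paint_ex s y R gs oy.
  move=> x yx; case: (pselect (orb (ker s) x y)) => xy.
    by exists id, f1; split=> //; exact: grp_id gg.
  by case: yx => [l sl' lx]; exists l, f1; split=> //; rewrite -lx; exact: orb_refl.
set t := add s _ f in gt.
have est : ext s t by apply: add_ext => x; exact: orb_outer.
have gkt := ker_group gt.
have fO1 z' : orb (ker s) y z' -> f z' = f1 z'.
  have [l [f' [_ _ _ [-> li] e]]] := hf y (orb_refl y gg).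
  by rewrite li // in e; [exact: e|exact: orb_refl].
(* By [dead], translated by [l], a newly coloured vertex has no uncoloured neighbour left. *)
have dnew x : open3 t x -> dom s x.
  move=> [[[dx _ _] _] [z nz xz]]; case: dx => // -[l sl lx]; case: nz.
  have [m sm [lm ml]] := grp_inv gg sl.
  case: (pselect (dom s z)) => [|dz]; [by left|right].
  rewrite -[z]ml; apply: (orb_step gg sl).
  apply: (dead y); [exact: orb_refl| |exact: ndom_grp].
  by have [_ ->] := grp_aut gg sl; rewrite ml lx.
have openK x : open3 t x -> open3 s x by move=> ox; apply: open3_ext (dnew _ ox) ox.
have oa : open3 s a.
  split; last by exists y.
  split=> //; split=> //; first exact: splits_moved sp.
  exists g => // -[k kk ka].
  have [h sh [gh hg]] := grp_inv gg sg.
  have [h' kh' [kh hk]] := grp_inv gk kk.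
  (* [e] fixes [a] and takes every vertex of the orbit of [y] out of it; so [a] would have 2q > 4
     uncoloured neighbours. *)
  pose e := h \o k; have se : grp s e by apply: (grp_comp gg) => //; case: kk.
  have ea : e a = a by rewrite /e /= ka gh.
  have nd z : orb (ker s) y z -> ~ dom s z by move=> [k' [sk' _] <-]; exact: ndom_grp.
  have neq z : orb (ker s) y z -> ~ orb (ker s) y (e z).
    move=> yz yez; apply: ngy.
    have : orb (ker s) (g y) (g (e z)) by apply/(ker_orb_conj _ _ gs sg).1.
    rewrite /e /= hg => /(orb_sym gk) kzy.
    apply: orb_trans (orb_trans gk yz _) kzy => //; exact: orb_img.
  pose C z := orb (ker s) y z /\ i z = i y.
  have fC : fin C by apply: fin_sub (fib_fin gs oy) => z [].
  have cC : card C = q by rewrite /C (fib_base fb) (fib_card fb).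
  have ie : injective e := aut_inj (grp_aut gg se).
  pose C' z := exists2 w, C w & e w = z.
  have fC' : fin C'.
    have [r hr] := fC; exists (map e r) => z [w /hr wr <-]; exact: map_f.
  have cC' : q <= card C' by rewrite -cC; apply: (@card_inj _ _ _ e) => [//|w|? ? _ _ /ie//]; exists w.
  have := outer_deg gs da; have := @card_disj _ C C' fC fC'.
  have : card (fun z => C z \/ C' z) <= card (fun z => E a z /\ ~ dom s z).
    apply: card_le; first by apply: fin_sub (E_fin a) => z [].
    move=> z [[yz iz]|[w [yw iw] <-]]; first by split; [exact: adj|exact: nd].
    split; last by apply: ndom_grp => //; exact: nd.
    by rewrite -ea; have [_ <-] := grp_aut gg se; exact: adj.
  move=> le eq le4; rewrite eq in le; first lia.
  by move=> z [yz _] [w [yw _] ez]; apply: (neq w) => //; rewrite ez.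
have na : ~ open3 t a.
  move=> [[_ cta] _].
  have tra z : orb (ker s) a z -> orb (ker t) a z.
    apply: (card_le_eq (orb_dom_fin gs da)) => [w|]; first exact: ext_orb.
    by rewrite ca cta.
  have [j jn jne] := red_split (n := 3) isT q4.
  have [k tk ik] := tr _ gkt (fun k => ext_ker est) tra y j (orb_refl y gk) jn.
  have sk : stab s (orb (ker s) y) f1 k.
    have kk : ker s k := ext_ker est tk.
    have [[_ fk] _] := tk; split=> // w yw.
    rewrite -!fO1 //; last exact: (orb_step gk).
    by apply: fk; exact: orb_ker_grp.
  have [] := stab_part gs oy fb cf (orb_refl y gk) (orb_img y sk).
  by rewrite ik (fib_base fb) => _ _ /eqP; rewrite (negbTE jne).
exists t; split=> //; apply/orP; left.
exact: (card_lt (open3_fin gs) openK oa na).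
Qed.

Lemma reduce_reach s u x y : good s -> dom s u -> reach s u x -> ~ dom s y ->
  splits (ker s) y x -> (forall h, grp s h -> orb (ker s) y (h y)) ->
  exists t, [/\ good t, ext s t, card (orb (ker t) u) < card (orb (ker s) u) &
    forall z, violator t z -> card (orb (ker s) u) <= card (orb (ker t) z) -> dom s z].
Proof.
move=> gs du ux ny sp0 Ly; have gk := ker_group gs.
have dx := reach_dom du ux.
have [[k0 kk0 yk0] _] := sp0; set a := k0 x in yk0.
have xa : orb (ker s) x a := orb_img x kk0.
have ay := E_sym yk0.
have sp : splits (ker s) y a by apply: splits_orb sp0 _ xa => //; exact: orb_refl.
have da : dom s a by apply: dom_orb dx _ => //; exact: orb_ker_grp.
have [t [gt st red_a domt newt]] := reduce_step gs ny da ay sp Ly.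
have [cx iso] := reach_iso gs du ux.
have ca : card (orb (ker s) a) = card (orb (ker s) u).
  by rewrite -cx; apply: card_eq => z; exact: iff_sym (orb_eqv z gk xa).
have gkt := ker_group gt.
exists t; split=> //; last first.
  move=> z vz le; have [dz _ _] := vz; case/domt: dz => // yz.
  by have := newt z yz vz; rewrite ca; lia.
rewrite ltnNge; apply/negP => le; apply: red_a.
have tru := card_le_eq (orb_dom_fin gs du) (fun z => @ext_orb s t u z st) le.
have trx := iso _ gkt (fun k => ext_ker st) tru.
move=> z az; have xz : orb (ker s) x z by apply: orb_trans xa az.
by apply: (orb_trans gkt (orb_sym gkt (trx _ xa))); exact: trx.
Qed.

(** New violators have smaller orbits than [u] had. So [u] leaves [violator3] if its orbit had size
    3; if it had size 2, [u] ceases to be moved and no violator is new. *)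
Lemma reduce_lower s u x y : good s -> violator s u -> reach s u x -> ~ dom s y ->
  splits (ker s) y x -> (forall h, grp s h -> orb (ker s) y (h y)) ->
  exists t, [/\ good t, ext s t & lower t s].
Proof.
move=> gs vu ux ny sp Ly; have [du mu _] := vu.
have [t [gt st cu old]] := reduce_reach gs du ux ny sp Ly.
have cs3 := good_card gs du.
have o3 z : open3 t z -> open3 s z.
  move=> oz; have [[vz cz] _] := oz; apply: (open3_ext gs gt st _ oz).
  by apply: old => //; rewrite cz.
have v3 z : violator3 t z -> violator3 s z.
  move=> oz; have [vz cz] := oz; apply: (violator3_ext gs gt st _ oz).
  by apply: old => //; rewrite cz.
exists t; split=> //; rewrite /lower (card_le (open3_fin gs) o3) (card_le (violator3_fin gs) v3) /=.
have c1 := moved_card gs du mu.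
apply/orP; right; case: (eqVneq (card (orb (ker s) u)) 3) => c3; apply/orP; [left|right].
  apply: (card_lt (violator3_fin gs) v3 (x := u)) => //.
  by move=> [_]; lia.
apply: (card_lt (violator_fin gs) _ (x := u)) => // [z vz|[dtu mtu _]].
  have [dz mz _] := vz; have cz := moved_card gt dz mz.
  by apply: (violator_ext gs gt st _ vz); apply: old => //; lia.
by have := moved_card gt dtu mtu; lia.
Qed.

(** Painting the fixed outer vertices white costs no automorphism. A fixed vertex still uncoloured
    afterwards has only new, white ones as coloured neighbours, which serves the case q = 1 of
    [kill_unforced]. *)
Lemma add_fixed s : good s -> exists t, [/\ good t, ext s t, forall g, grp s g -> grp t g,
  forall x, violator t x -> dom s x &
  forall x a, ~ dom t x -> (forall k, ker t k -> k x = x) -> dom t a -> E a x -> near t 2 a].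
Proof.
move=> gs; have gg := good_grp gs.
pose Y x := outer s x /\ forall k, ker s k -> k x = x.
pose t := add s Y (fun=> false).
have st : ext s t by apply: add_ext => x [].
have gt : good t.
  apply: add_good => //; first by move=> x [].
  - move=> g x sg [ox fx]; split; first exact: outer_grp.
    move=> k kk; have [h sh [gh hg]] := grp_inv gg sg.
    by apply: (can_inj hg); rewrite gh; apply: (fx (h \o k \o g)); exact: ker_conj.
  - move=> x [_ fx]; apply: leq_trans (_ : 1 <= 3) => //.
    apply: (@card_le_seq _ [:: x]) => _ [k tk <-].
    by rewrite fx ?inE //; exact: ext_ker tk.
exists t; split=> //.
- by move=> x [[//|[_ fx]] [k tk kx] _]; case: kx; apply: fx; exact: ext_ker tk.
move=> x a nx fx [da|Ya] ax.
  case: (nx); right; split.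
    by split; [move=> dx; apply: nx; left|exists a].
  by move=> k [sk k0]; apply: fx.
exists a; split; [by right|by rewrite /= asboolT|exact: ball_refl].
Qed.

Lemma lower_le s t r : good s -> good t -> ext s t -> (forall x, violator t x -> dom s x) ->
  lower r t -> lower r s.
Proof.
move=> gs gt st old.
have : card (violator t) <= card (violator s).
  by apply: card_le (violator_fin gs) _ => z vz; apply: (violator_ext gs gt st _ vz); exact: old.
have : card (violator3 t) <= card (violator3 s).
  apply: card_le (violator3_fin gs) _ => z vz; apply: (violator3_ext gs gt st _ vz).
  by apply: old; case: vz.
have : card (open3 t) <= card (open3 s).
  apply: card_le (open3_fin gs) _ => z vz; apply: (open3_ext gs gt st _ vz).
  by apply: old; case: vz => -[].
by rewrite /lower; lia.
Qed.

(** Induction along [lower]. An unsplit [y] gives one class, which is never forced. A split [y] with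
    invariant orbit goes to [reduce_lower]. Otherwise [kill_unforced] applies or, in the forced
    case, [kill_forced] if the orbit of [y] has an uncoloured neighbour outside the group orbit, and
    else [dead_end]. *)
Lemma kill_one s g : good s -> grp s g -> ~ ker s g -> exists t, progress s t.
Proof.
move: s g; apply: (lex3_ind (m1 := fun s => card (open3 s)) (m2 := fun s => card (violator3 s))
  (m3 := fun s => card (violator s))) => s0 IH g0 gs0 sg0 nk0.
have [s [gs st grpst oldst fixs]] := add_fixed gs0.
have finish t : good t -> ext s t -> lower t s -> exists t, progress s0 t.
  move=> gt ts lo; have s0t := ext_trans st ts.
  case: (pselect (exists2 h, grp t h & ~ ker t h)) => [[h th nh]|no].
    have [|r pr] := IH t _ h gt th nh; first exact: (lower_le gs0 gs st oldst lo).
    by exists r; exact: progress_ext pr.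
  (* If the group has shrunk to the kernel, the coset of [g0] is lost as well. *)
  exists t; split=> //; exists g0 => // h th hg; apply: nk0; split=> // x x0.
  by rewrite -hg //; have [_ ->] : ker t h by apply: contrapT => nh; apply: no; exists h.
suff : (exists t, progress s t) \/ (exists t, [/\ good t, ext s t & lower t s]).
  by case=> [[t pt]|[t [gt ts lo]]]; [exists t; exact: progress_ext pt|exact: finish lo].
have gk := ker_group gs; have gg := good_grp gs.
have nk : ~ ker s g0 by move=> [_ g00]; apply: nk0.
case: (reach_violator gs (grpst _ sg0) nk); last first.
  move=> [y [a [h [ny da ay nsp [sh nhy]]]]]; left.
  have fb := fib_unsplit gs ny da ay nsp.
  have oy : outer s y by split=> //; exists a.
  apply: (kill_unforced gs ny da ay fb _ _ sh nhy) => // c1.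
  apply: (fixs y) => // k kk; apply: (card1_eq (fib_fin gs oy)).
  - by rewrite c1.
  - exact: orb_img.
  by apply: orb_refl.
move=> [u [x [y [vu ux ny sp0]]]].
have [[k0 kk0 yk0] _] := sp0; set a := k0 x in yk0.
have xa : orb (ker s) x a := orb_img x kk0.
have ay := E_sym yk0.
have sp : splits (ker s) y a by apply: splits_orb sp0 _ xa => //; exact: orb_refl.
have [du _ _] := vu.
have da : dom s a by apply: (dom_orb gs (reach_dom du ux)); exact: orb_ker_grp.
case: (pselect (forall h, grp s h -> orb (ker s) y (h y))) => [Ly|].
  by right; exact: (reduce_lower gs vu ux ny sp0 Ly).
move=> /existsNP[h /not_implyP[sh nhy]].
have [q [i [fb n1 tr adj]]] := fib_split gs ny da ay sp.
case fo : (forced (card (orb (ker s) a)) q); last first.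
  left; apply: (kill_unforced gs ny da ay fb _ _ sh nhy); first by rewrite fo.
  by move=> _; apply: moved_near => //; exact: splits_moved sp.
have [ca q2 _ _] := forced_red (fib_q fb) fo.
case: (pselect (exists b z, [/\ orb (ker s) y b, E b z, ~ dom s z & ~ orb (grp s) y z]));
    last first.
  move=> no; right; rewrite ca in fb tr.
  apply: (dead_end gs ny da ay sp ca fb q2 tr adj sh nhy) => b z yb bz nz.
  by apply: contrapT => nyz; apply: no; exists b, z.
move=> [b [z [[k kk kb] bz nz nLz]]]; left; subst b.
have sk : grp s k by case: kk.
have [m km [mk kmc]] := grp_inv gk kk.
have [_ ak] := grp_aut gk kk.
have kab : E (k a) (k y) by rewrite -ak.
have nky : ~ dom s (k y) by exact: ndom_grp.
have dka : dom s (k a) by exact: good_dom.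
have yky : orb (ker s) y (k y) by exact: orb_img.
have aka : orb (ker s) a (k a) by exact: orb_img.
have spk : splits (ker s) (k y) (k a) := splits_orb gk sp yky aka.
have [q' [i' [fb' _ _ _]]] := fib_split gs nky dka kab spk.
have cka : card (orb (ker s) (k a)) = card (orb (ker s) a).
  by apply: card_eq => w; exact: iff_sym (orb_eqv w gk aka).
have oky : outer s (k y) by split=> //; exists (k a).
have oy : outer s y by split=> //; exists a.
(* The classes are formed anew from the base [k y]; their size is unchanged, being a third of the
   orbit. *)
have qq : q' = q.
  rewrite cka ca in fb'; rewrite ca in fb.
  have e := fib_size3 gs oky fb'; have e' := fib_size3 gs oy fb.
  have : card (orb (ker s) (k y)) = card (orb (ker s) y).
    by apply: card_eq => w; exact: iff_sym (orb_eqv w gk yky).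
  lia.
apply: (kill_forced (g := h \o m) gs oky fb' _ _ _ bz nz).
- by rewrite cka qq.
- by apply: (grp_comp gg) => //; case: km.
- by rewrite /= mk => kyh; apply: nhy; exact: orb_trans kyh.
move=> kyz; apply: nLz; apply: (orb_trans gg _ kyz); exact: orb_img.
Qed.

Definition rooted s := forall g, grp s g -> ker s g.

(** The group has finitely many restrictions to [Ball4], and each [progress] loses one. *)
Lemma kill_all s : good s -> exists t, [/\ good t, ext s t & rooted t].
Proof.
have fD : fin Ball4 := ball_fin 4 (root W).
pose d := elems Ball4.
pose A s w := exists2 g, grp s g & w = map g d.
have fA s' : good s' -> fin (A s').
  move=> gs; apply: fin_sub (fin_words d (size d)) => w [g sg ->].
  split; first by rewrite size_map.
  by move=> z /mapP[x /(elemsP _ fD) x0 ->]; apply/(elemsP _ fD); exact: (good_dom0 gs).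
move: s; suff main c s : good s -> card (A s) <= c -> exists t, [/\ good t, ext s t & rooted t].
  by move=> s gs; exact: (main (card (A s))).
elim: c s => [|c IH] s gs le.
  have := @card_gt0 _ _ (map id d) (fA _ gs); suff h : A s (map id d) by move=> /(_ h); lia.
  by exists id => //; exact: grp_id (good_grp gs).
case: (pselect (rooted s)) => [rs|/existsNP[g /not_implyP[sg nk]]].
  by exists s; split=> //; exact: ext_refl.
have [t [gt st [g' sg' hg']]] := kill_one gs sg nk.
have [|r [gr tr rr]] := IH t gt.
  suff : card (A t) < card (A s) by lia.
  apply: (@card_lt _ _ _ (map g' d)); first exact: fA.
  - by move=> w [h th ->]; exists h => //; case: st => _ _; apply.
  - by exists g'.
  move=> [h th e]; apply: (hg' h th) => x x0.
  have xd : x \in d by apply/(elemsP _ fD).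
  by move/eq_in_map: e => /(_ x xd).
by exists r; split=> //; exact: ext_trans tr.
Qed.

(** * Fixing vertices and colouring outwards *)

Lemma rooted_ext s t : rooted s -> ext s t -> rooted t.
Proof. by move=> rs [_ _ gg] g tg; split=> //; have [_] := rs g (gg g tg). Qed.

(** Once group and kernel coincide every kernel orbit is invariant, and [reduce_reach] shrinks the
    orbit of [u] step by step. *)
Lemma fix_one s u : good s -> rooted s -> dom s u ->
  exists t, [/\ good t, ext s t & ~ moved t u].
Proof.
move: {2}(card _) (leqnn (card (orb (ker s) u))) => c.
elim: c s => [|c IH] s le gs rs du; have gk := ker_group gs.
  by have := card_gt0 (orb_dom_fin gs du) (orb_refl u gk); lia.
case: (pselect (moved s u)) => mu; last by exists s; split=> //; exact: ext_refl.
have [x [y [ux ny sp]]] := reach_out gs du mu.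
have [|t [gt st cu _]] := reduce_reach gs du ux ny sp.
  by move=> h /rs kh; exact: orb_img.
have [|||r [gr tr nr]] := IH t _ gt; first by lia.
- exact: rooted_ext st.
- by case: st => + _ _; apply.
by exists r; split=> //; exact: ext_trans tr.
Qed.

Lemma fix_seq s (l : seq V) : good s -> rooted s -> (forall u, u \in l -> dom s u) ->
  exists t, [/\ good t, ext s t & forall u, u \in l -> ~ moved t u].
Proof.
elim: l s => [|u l IH] s gs rs dl; first by exists s; split=> //; exact: ext_refl.
have [|t [gt st nu]] := fix_one gs rs (u := u); first by apply: dl; exact: mem_head.
have [||r [gr tr nr]] := IH t gt; first exact: rooted_ext st.
  by move=> v vl; case: st => + _ _; apply; apply: dl; rewrite inE vl orbT.
exists r; split=> //; first exact: ext_trans tr.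
by move=> v; rewrite inE => /orP[/eqP->|/nr//] /(ext_moved tr).
Qed.

Lemma add_one s y : good s -> outer s y -> exists t, [/\ good t, ext s t & dom t y].
Proof.
move=> gs oy; have gg := good_grp gs; have gk := ker_group gs.
have [ny [a da ay]] := oy.
have [n [q [i fb]]] : exists n q i, fib s y n q i.
  case: (pselect (splits (ker s) y a)) => sp; last first.
    by exists 1, (card (orb (ker s) y)), (fun=> 0); exact: fib_unsplit ay sp.
  by have [q [i [fb _ _ _]]] := fib_split gs ny da ay sp; exists (card (orb (ker s) a)), q, i.
have pr := std_profile (fib_n fb) (fib_q fb).
have [f1 cf _] := color_ex gs oy fb pr.
have ff : fine s y f1.
  by apply: (counted_fine gs oy fb pr cf) => ->; left; exact: std_one (fib_n fb).
have [|f [gt _]] := @paint_ex s y (fun _ _ _ => True) gs oy.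
  by move=> x [l sl <-]; exists l, f1; split=> //; exact: orb_refl.
exists (add s (orb (grp s) y) f); split=> //; first by apply: add_ext => x; exact: orb_outer.
by right; exact: orb_refl.
Qed.

Lemma add_seq s (l : seq V) : good s -> (forall y, y \in l -> exists2 a, dom s a & E a y) ->
  exists t, [/\ good t, ext s t & forall y, y \in l -> dom t y].
Proof.
elim: l s => [|y l IH] s gs dl; first by exists s; split=> //; exact: ext_refl.
have [t [gt st dy]] : exists t, [/\ good t, ext s t & dom t y].
  case: (pselect (dom s y)) => dy; first by exists s; split=> //; exact: ext_refl.
  by apply: add_one => //; split=> //; apply: dl; exact: mem_head.
have [|r [gr tr nr]] := IH t gt.
  move=> v vl; have [|a da av] := dl v; first by rewrite inE vl orbT.
  by exists a => //; case: st => + _ _; apply.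
exists r; split=> //; first exact: ext_trans tr.
by move=> v; rewrite inE => /orP[/eqP->|/nr//]; case: tr => + _ _; apply.
Qed.

(** The hypotheses follow the quantifier so that a choice function is defined on all states. *)
Lemma next_state s : exists t, good s -> rooted s -> [/\ good t, ext s t,
  forall u, dom s u -> ~ moved t u & forall u y, dom s u -> E u y -> dom t y].
Proof.
case: (pselect (good s /\ rooted s)) => [[gs rs]|no]; last first.
  by exists s => gs rs; case: no.
have [t [gt st nt]] : exists t, [/\ good t, ext s t & forall u, dom s u -> ~ moved t u].
  have [|t [gt st nt]] := fix_seq (l := elems (dom s)) gs rs.
    by move=> u /(elemsP _ (good_fin gs)).
  by exists t; split=> // u /(elemsP _ (good_fin gs)); exact: nt.
have [|r [gr tr dr]] := add_seq (l := flatten [seq nb u | u <- elems (dom s)]) gt.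
  move=> y /flatten_mapP[u /(elemsP _ (good_fin gs)) du /nbP uy].
  by exists u => //; case: st => + _ _; apply.
exists r => _ _; split=> //; first exact: ext_trans tr.
  by move=> u du /(ext_moved tr); exact: nt.
move=> u y du uy; apply: dr; apply/flatten_mapP; exists u; last exact/nbP.
by apply/(elemsP _ (good_fin gs)).
Qed.

(** * The initial state and the limit colouring *)

Definition init := State Ball4 (fun x => `[< Ball3 x >])
  (fun g => [/\ is_aut E g, forall x, Ball4 x <-> Ball4 (g x) &
     forall x, Ball4 x -> Ball3 x <-> Ball3 (g x)]).

Lemma ball_pred n x y : ball n x y -> x = y \/ exists2 z, ball n x z & E z y.
Proof.
elim: n => [|n IH] /=; first by left.
case=> [/IH[|[z xz zy]]|[z xz zy]]; [by left|right|right]; exists z => //; left => //.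
Qed.

Lemma init_good : good init.
Proof.
have fD : fin Ball4 := ball_fin 4 (root W).
split=> //=.
- split=> /=.
  + by move=> g [].
  + by split=> //; split=> //; exists id.
  + move=> g h [[[g' [gg' g'g]] ag] dg bg] [[[h' [hh' h'h]] ah] dh bh]; split=> /=.
    * split; first by exists (h' \o g'); split=> x /=; rewrite ?gg' ?hh' ?h'h ?g'g.
      by move=> x y; exact: iff_trans (ah x y) (ag _ _).
    * by move=> x; exact: iff_trans (dh x) (dg _).
    * by move=> x x0; apply: iff_trans (bh x x0) (bg (h x) ((dh x).1 x0)).
  move=> g [[[h [gh hg]] ag] dg bg]; exists h => //; split.
  + by split; [exists g|move=> x y; have := ag (h x) (h y); rewrite !hg; exact: iff_sym].
  + by move=> x; have := dg (h x); rewrite hg; exact: iff_sym.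
  move=> x x0; have hx0 : Ball4 (h x) by have := dg (h x); rewrite hg => e; apply: e.2.
  by have := bg (h x) hx0; rewrite hg; exact: iff_sym.
- by move=> g x [_ dg _] /dg.
- by move=> g x [_ dg _] /dg.
- by move=> g x [_ _ bg] x0; apply: asbool_equiv_eq; exact: iff_sym (bg x x0).
(* The vertex [x] is not the root, whose neighbours are coloured, so it has a predecessor in
   [Ball4]. *)
- move=> x y x0 ny xy; case: (ball_pred x0) => [e|[z z0 zx]].
    case: ny; rewrite -e in xy; left; left; left; right.
    by exists (root W).
  by exists z => //; exact: E_sym.
- move=> x x0; apply: leq_trans (_ : 1 <= 3) => //.
  by apply: (@card_le_seq _ [:: x]) => _ [k [_ k0] <-]; rewrite k0 ?inE.
- by move=> x _ /asboolP.
move=> chi hc g ag dg cg; split=> // x x0.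
have := cg x; rewrite !hc //; last exact: (dg x).1.
by move=> e; split=> /asboolP h; apply/asboolP; [rewrite e|rewrite -e].
Qed.

Theorem world_distinguishing : (forall x, exists n, ball n (root W) x) ->
  exists chi : V -> bool, forall g, is_aut E g -> (forall x, chi (g x) = chi x) ->
    forall x, g x = x.
Proof.
move=> conn.
have [s0 [gs0 is0 rs0]] := kill_all init_good.
have [F hF] := choice next_state.
pose S n := iter n F s0.
have gr n : good (S n) /\ rooted (S n).
  elim: n => [//|n [gs rs]]; have [gt st _ _] := hF _ gs rs.
  by split=> //; exact: rooted_ext st.
have step n := hF _ (gr n).1 (gr n).2.
have mono n m : n <= m -> ext (S n) (S m).
  move=> /subnKC <-; elim: (m - n) => [|d IH]; first by rewrite addn0; exact: ext_refl.
  by rewrite addnS; apply: ext_trans IH _; case: (step (n + d)).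
have dball n x : ball n (root W) x -> dom (S n) x.
  elim: n x => [|n IH] x /=.
    by move=> <-; apply: (good_Ball4 gs0); exact: ball_refl.
  have [_ [up _ _] _ nbs] := step n.
  by case=> [/IH/up|[z /IH dz zx]] //; exact: nbs dz zx.
have exN x : exists n, dom (S n) x.
  by have [n xn] := conn x; exists n; exact: dball.
have [N hN] := choice exN.
pose chi x := col (S (N x)) x.
have chiE n x : dom (S n) x -> chi x = col (S n) x.
  move=> dx; have [_ c1 _] := mono _ _ (leq_maxl n (N x)).
  have [_ c2 _] := mono _ _ (leq_maxr n (N x)).
  by rewrite -c1 // c2.
have i0 n : ext init (S n) by apply: ext_trans is0 (mono 0 n _).
have chi0 x : Ball4 x -> chi x = `[< Ball3 x >].
  by move=> x0; have [d c _] := i0 0; rewrite (chiE 0) ?c //; exact: d.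
have B3D0 x : Ball3 x -> Ball4 x by left.
have blackB x : Ball4 x -> chi x -> Ball3 x by move=> x0; rewrite chi0 // => /asboolP.
have chiB x : Ball3 x -> chi x by move=> x3; rewrite chi0 ?asboolT //; exact: B3D0.
exists chi => g ag cg.
have sub h x : is_aut E h -> (forall x, chi (h x) = chi x) -> Ball3 x -> Ball3 (h x).
  move=> ah ch x3; set u := h (root W).
  have blk w : ball 3 u w -> chi w.
    by move=> /(aut_ball_inv ah)[z z3 <-]; rewrite ch; exact: chiB.
  (* The ball of radius 3 about [u] is all black, while a black vertex outside [Ball3] has a white
     one within distance 3. *)
  have u3 : Ball3 u.
    apply: contrapT => nu.
    have cu : chi u by apply: blk; exact: ball_refl.
    have du := hN u; rewrite /chi in cu.
    have [[w [dw cw uw]] _] := good_near (gr (N u)).1 du cu nu.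
    by move/negP: cw; apply; rewrite -chiE //; exact: blk.
  (* A black path starting in [Ball3] cannot leave it: the next vertex lies in [Ball4], where only
     [Ball3] is black. *)
  have all n w : n <= 3 -> ball n u w -> Ball3 w.
    elim: n w => [|n IH] w n3 /=; first by move=> <-.
    have down v : ball n u v -> Ball3 v by apply: IH; exact: ltnW.
    case=> [/down//|[z uz zw]]; apply: blackB; first by right; exists z => //; exact: down.
    have lift m : n.+1 <= m -> ball m u w.
      elim: m => // m IHm; rewrite leq_eqVlt => /orP[/eqP[<-]|/IHm h']; last by left.
      by right; exists z.
    exact: blk (lift 3 n3).
  by apply: (all 3) => //; exact: aut_ball x3.
have sub0 h x : is_aut E h -> (forall x, chi (h x) = chi x) -> Ball4 x -> Ball4 (h x).
  move=> ah ch [x3|[z z3 zx]]; first by left; exact: sub.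
  by right; exists (h z); [exact: sub|case: ah => _ <-].
have [[h [gh hg]] ag'] := ag.
have ah : is_aut E h by split; [exists g|move=> x y; have := ag' (h x) (h y); rewrite !hg; exact: iff_sym].
have ch x : chi (h x) = chi x by rewrite -[in RHS](hg x) cg.
have g0 x : Ball4 x <-> Ball4 (g x).
  by split=> [|/(sub0 h _ ah ch)]; [exact: sub0|rewrite gh].
(* A vertex coloured at stage [N x] is unmoved at the following stage, whose group contains [g] and
   equals its kernel. *)
move=> x; have [gn rn] := gr (N x).+1.
have [_ _ fx _] := step (N x).
apply: contrapT => gx; apply: (fx x (hN x)); exists g => //.
by apply: rn; apply: (good_all gn (chi := chi)) => // y dy; exact: chiE.
Qed.

End Extension.

(** * Transfer to the given graph *)

HB.instance Definition _ (G : graph) := gen_eqMixin (vert G).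

Lemma InP (T : eqType) (x : T) (l : seq T) : List.In x l <-> x \in l.
Proof.
elim: l => //= y l IH; rewrite inE; split.
  by case=> [->|/IH->]; rewrite ?eqxx ?orbT.
by case/orP=> [/eqP->|/IH]; [left|right].
Qed.

Lemma NoDup_uniq (T : eqType) (l : seq T) : List.NoDup l -> uniq l.
Proof. by elim=> //= x s nx _ ->; rewrite andbT; apply/negP => /InP. Qed.

Theorem theorem1p2 (G : graph) :
  connected G ->
  max_degree_le G 5 ->
  (forall g, automorphism G g -> (exists v, g v <> v) -> infinite_motion_of G g) ->
  dist_number_le G 2.
Proof.
move=> conn deg mot.
have [N hN] := choice deg.
(* Without vertices any colouring works; otherwise any vertex may be the root. *)
case: (pselect (exists r : G, True)) => [[r _]|no]; last first.
  by exists (fun=> 0); split=> [v|g _ _ v]; [exact/ltP|case: no; exists v].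
have motion g : is_aut (adj G) g -> fin (fun x : G => g x <> x) -> forall x, g x = x.
  move=> ag [l hl] x; apply: contrapT => gx.
  apply: (mot g ag (ex_intro _ x gx)).
  by exists l => v /hl /InP.
have nbP (x y : G) : adj G x y <-> y \in N x.
  by have [_ [_ e]] := hN x; exact: iff_trans (e y) (InP y (N x)).
have nb_uniq x : uniq (N x : seq G) by have [u _] := hN x; exact: NoDup_uniq.
have nb_size x : size (N x) <= 5 by have [_ [/leP]] := hN x.
pose W := World (@adj_sym G) nbP nb_uniq nb_size r motion.
have [x|chi hchi] := @world_distinguishing W.
  have := @clos_rt_rtn1 _ _ _ _ (conn r x); elim=> [|y z yz _ [n ry]]; first by exists 0.
  by exists n.+1; right; exists y.
exists (fun v => chi v : nat); split=> [v|g ag cg]; first by case: (chi v); apply/ltP.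
by apply: hchi => // x; have := cg x; do 2 case: (chi _).
Qed.
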